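(* Let $z_1,z_2,\dots$ be independent random variables with $z_j\ge 0$, with means $\mu_j=\mathbb{E}(z_j)$ and variances $\sigma_j^2=\mathrm{Var}(z_j)$. Assume there are constants $0<\underline\mu\le\overline\mu<\infty$, $\lambda<\infty$, $\alpha>0$ and $M_\alpha<\infty$ such that for all $j$: $\underline\mu\le\mu_j\le\overline\mu$; $|\mathbb{E}((z_j-\mu_j)^k)|\le\lambda$ for $2\le k\le 6$; and $\mathbb{E}(z_j^{-\alpha})\le M_\alpha$. Let $z_{1:d}=\sum_{j=1}^dz_j$, $\mu_{1:d}=\sum_{j=1}^d\mu_j$ and $\sigma^2_{1:d}=\sum_{j=1}^d\sigma_j^2$, with $\sigma^2_{1:d}>0$. Let $f(\boldsymbol z)=(z_{1:d}/\mu_{1:d})^p$ for nonzero real $p<1$. Then the mean dimension of $f$ satisfies $$\nu(f)\le 1+\frac{(p-1)^2}{2}\,\frac{\sigma^2_{1:d}}{(\mu_{1:d})^2}+O\Bigl(\frac1{d^2}\Bigr)$$ as $d\to\infty$.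
   Context: Mean dimension: let $f$ be a function of $d$ independent random variables $\boldsymbol z=(z_1,\dots,z_d)$ with $0<\mathrm{Var}(f(\boldsymbol z))<\infty$. Its ANOVA decomposition is $f=\sum_{u\subseteq\{1,\dots,d\}}f_u$, where $f_u(\boldsymbol z)=\mathbb{E}(f(\boldsymbol z)\mid z_j, j\in u)-\sum_{v\subsetneq u}f_v(\boldsymbol z)$; the $f_u$ are mutually orthogonal, and $f_\varnothing=\mathbb{E}(f(\boldsymbol z))$. With $\sigma_u^2=\mathrm{Var}(f_u(\boldsymbol z))$ and $\sigma^2=\mathrm{Var}(f(\boldsymbol z))=\sum_u\sigma_u^2$, the mean dimension is $\nu(f)=\frac1{\sigma^2}\sum_{u}|u|\,\sigma_u^2$. Equivalently $\nu(f)=\frac1{\sigma^2}\sum_{j=1}^d\overline\tau_j^2$ with $\overline\tau_j^2=\sum_{u\ni j}\sigma_u^2=\mathbb{E}(\mathrm{Var}(f(\boldsymbol z)\mid z_\ell,\ell\ne j))$. The asymptotic statement concerns all sufficiently large $d$, for which $f$ is square integrable. *)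

(* Defs.v *)
From HB Require Import structures.
From mathcomp Require Import all_boot all_order all_algebra finmap.
From mathcomp Require Import all_classical all_reals all_analysis.
Set Implicit Arguments.
Unset Strict Implicit.
Unset Printing Implicit Defensive.
Import Order.TTheory GRing.Theory Num.Theory.
Import numFieldNormedType.Exports.
Local Open Scope classical_set_scope.
Local Open Scope ring_scope.

Definition mutually_independent {dT : measure_display} {T : measurableType dT}
    {R : realType} (P : probability T R) {I : choiceType} (z : I -> T -> R) :=
  forall (J : {fset I}) (B : I -> set R),
    (forall j, j \in J -> measurable (B j)) ->
    (P (\bigcap_(j in [set` J]) z j @^-1` B j)
     = \prod_(j <- J) P (z j @^-1` B j))%E.

Section conditional_expectation.
Context {dT : measure_display} {T : measurableType dT} {R : realType}.
Variable P : probability T R.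

Definition is_condexp (G : set (set T)) (X Y : T -> R) :=
  [/\ preimage_set_system setT Y measurable `<=` G,
      P.-integrable setT (EFin \o Y) &
      forall A, G A -> (\int[P]_(w in A) (Y w)%:E = \int[P]_(w in A) (X w)%:E)%E].

(* A chosen version; it is the zero function when no version exists, which does
   not happen for integrable [X] and a sub-sigma-algebra [G]. *)
Definition condexp (G : set (set T)) (X : T -> R) : T -> R :=
  xget (cst 0) (is_condexp G X).

End conditional_expectation.

Section mean_dimension.
Context {dT : measure_display} {T : measurableType dT} {R : realType}.
Variables (P : probability T R) (d : nat).
Variables (z : 'I_d -> T -> R) (f : ('I_d -> R) -> R).

Let fz : T -> R := fun w => f (fun j => z j w).

Definition sigma_of (u : {set 'I_d}) : set (set T) :=
  <<s \bigcup_(j in [set` u]) preimage_set_system setT (z j) measurable >>.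

(* [n] only bounds the depth of the recursion; any [n >= #|u|] gives the same
   function, see [anovaE]. *)
Fixpoint anova_rec (n : nat) (u : {set 'I_d}) : T -> R :=
  fun w => condexp P (sigma_of u) fz w
    - \sum_(v : {set 'I_d} | v \proper u)
        (if n is m.+1 then anova_rec m v w else 0).

Definition anova (u : {set 'I_d}) : T -> R := anova_rec #|u| u.

Lemma anova_rec_stable n (u : {set 'I_d}) : (#|u| <= n)%N -> anova_rec n u = anova u.
Proof.
rewrite /anova; have [k] := ubnP #|u|.
elim: k n u => // k IH n u; rewrite ltnS => uk un.
apply/funext => w; case: n un => [|n] un.
  by move: un; rewrite leqn0 => /eqP ->.
case E : #|u| uk un => [|m] uk un /=; congr (_ - _); apply: eq_bigr => v vu;
  have := proper_card vu; rewrite E // ltnS => vm.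
have vk : (#|v| < k)%N by exact: leq_ltn_trans vm uk.
by rewrite (IH n v vk) ?(IH m v vk) //; exact: leq_trans vm un.
Qed.

Lemma anovaE (u : {set 'I_d}) w :
  anova u w = condexp P (sigma_of u) fz w
              - \sum_(v : {set 'I_d} | v \proper u) anova v w.
Proof.
rewrite -(@anova_rec_stable #|u|.+1) //=; congr (_ - _).
by apply: eq_bigr => v /proper_card/ltnW vu; rewrite anova_rec_stable.
Qed.

(* Meaningful when [fz] is square integrable with positive variance. *)
Definition mean_dim : R :=
  (\sum_(u : {set 'I_d}) #|u|%:R * fine 'V_P[anova u]) / fine 'V_P[fz].

End mean_dimension.

Section partial_sums.
Context {dT : measure_display} {T : measurableType dT} {R : realType}.
Variables (P : probability T R) (z : nat -> T -> R).

Definition mean_sum (d : nat) : R := \sum_(j < d) fine 'E_P[z j].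

Definition variance_sum (d : nat) : R := \sum_(j < d) fine 'V_P[z j].

Definition power_fun (p : R) (d : nat) (x : 'I_d -> R) : R :=
  ((\sum_(j < d) x j) / mean_sum d) `^ p.

End partial_sums.

(* Main.v *)
(** Write a(u) = Var(f_u), so that nu(f) = 1 + N / Var(f) with
    N = sum_(u nonempty) (|u| - 1) a(u) <= sum_(i < j) sum_(u containing i and j) a(u).
    For a pair i, j the inner sum is at most the mean square distance from f to the sums of
    a function free of z_i and a function free of z_j.  Choosing these functions so that the
    residual is the mixed second difference of h(x) = (x / mu)^p gives the bound
    p^2 (p-1)^2 sigma_i^2 sigma_j^2 / mu^4 * E (A / mu)^(2p-4), where A is the sum of the other
    coordinates, and this negative moment is 1 + O(1/d): the AM-GM inequality reduces negative
    moments of averages to products of small negative moments of the z_j.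
    Conversely (x^p - 1)(x - 1) / p >= (x-1)^2 + (p-1)/2 (x-1)^3, at x = z_(1:d) / mu, yields
    Var(f) >= p^2 (sigma^2 / mu^2 - (1-p) kappa_3 / mu^3), where the third cumulant kappa_3 of
    the sum is O(d).  Dividing the two bounds gives the theorem. *)

Require Import Defs.
From HB Require Import structures.
From mathcomp Require Import all_boot all_order all_algebra finmap.
From mathcomp Require Import all_classical all_reals all_analysis measurable_realfun.
From mathcomp Require Import ring lra zify.
Import Order.TTheory GRing.Theory Num.Theory.
Import numFieldNormedType.Exports.
Local Open Scope classical_set_scope.
Local Open Scope ring_scope.
Set Implicit Arguments.
Unset Strict Implicit.
Unset Printing Implicit Defensive.

(** * Independence *)

(** Each coordinate has only a negative moment of some order [alpha], possibly tiny, whereas the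
    pair bound needs the order 4 - 2p for a sum, to accuracy O(1/d). Boundedness holds once d is
    large compared with 1 / [alpha]. Accuracy needs a second-order expansion at 1, whose remainder
    contains a negative moment of order 6 - 2p correlated with the square that it multiplies;
    cutting the coordinates into two halves removes this correlation. The second obstacle is that
    single variances have no lower bound: sigma^2 may stay bounded while mu and the available bound
    on kappa_3 grow like d. The lower bound on Var(f) is useful only when the skewness term is at
    most half of the main one. This comes from interpolating third moments between second and fourth
    ones, with a weight proportional to d. Finally, conditional expectations are only chosen
    versions. Explicit partial integrals of a function of the sum are studied instead, and the
    results are transferred almost everywhere. *)

Section independence.
Context {dT : measure_display} {T : measurableType dT} {R : realType}.
Variable P : probability T R.

(** Both sides are finite measures in [B], a restriction and a rescaling of [P], and they agree on a
    generating pi-system. *)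
Lemma indep_sigma_ext (G : set (set T)) (A : set T) :
  G `<=` measurable -> setI_closed G -> G setT -> measurable A ->
  (forall B, G B -> P (B `&` A) = (P A * P B)%E) ->
  forall B, <<s G >> B -> P (B `&` A) = (P A * P B)%E.
Proof.
move=> Gm GI GT mA GA B sB.
pose r : {nonneg R} := NngNum (fine_ge0 (measure_ge0 P A)).
have rE : (r%:num%:E = P A)%E by rewrite /= fineK// fin_num_measure.
have := @g_sigma_algebra_measure_unique _ R T G Gm (fun=> setT) (fun=> GT) _
  (mrestr P mA) (mscale r P) GI.
rewrite /mscale /= /mrestr -rE; apply => //.
- by rewrite bigcup_const.
- by move=> C GC; rewrite /mrestr /mscale GA// rE.
- by move=> k; rewrite /mrestr setTI ltey_eq fin_num_measure.
Qed.

(** The joint law is the product of the two laws, so Tonelli applies. Both integrals are pulled back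
    to [T], which keeps product measures out of later statements. *)
Lemma ge0_integral_decouple {d1 d2} {Y1 : measurableType d1} {Y2 : measurableType d2}
    (phi : T -> Y1) (psi : T -> Y2) (k : Y1 * Y2 -> \bar R) :
  measurable_fun setT phi -> measurable_fun setT psi ->
  (forall A B, measurable A -> measurable B ->
    P (phi @^-1` A `&` psi @^-1` B) = (P (phi @^-1` A) * P (psi @^-1` B))%E) ->
  measurable_fun setT k -> (forall y, 0 <= k y)%E ->
  (\int[P]_w k (phi w, psi w) = \int[P]_w \int[P]_v k (phi w, psi v))%E.
Proof.
move=> mphi mpsi ind mk k0.
pose X1 : {RV P >-> Y1} := HB.pack phi (isMeasurableFun.Build _ _ _ _ _ mphi).
pose X2 : {RV P >-> Y2} := HB.pack psi (isMeasurableFun.Build _ _ _ _ _ mpsi).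
have mp : measurable_fun setT (fun w => (phi w, psi w)) by exact: measurable_fun_pair.
pose X : {RV P >-> (Y1 * Y2)%type} :=
  HB.pack (fun w => (phi w, psi w)) (isMeasurableFun.Build _ _ _ _ _ mp).
rewrite -(@ge0_integral_distribution _ _ _ _ _ P X k)//.
transitivity (\int[distribution P X1 \x distribution P X2]_y k y)%E.
  apply/esym; apply: eq_measure_integral => A mA _.
  by apply: product_measure_unique => // ? ? ? ?; rewrite -ind.
rewrite fubini_tonelli1//.
rewrite (@ge0_integral_distribution _ _ _ _ _ P X1)//; last 2 first.
- exact: measurable_fun_fubini_tonelli_F.
- by move=> y; exact: integral_ge0.
apply: eq_integral => w _; rewrite /fubini_F /=.
rewrite (@ge0_integral_distribution _ _ _ _ _ P X2)//.
exact: measurableT_comp.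
Qed.

Variables (d : nat) (z : 'I_d -> T -> R).
Hypothesis mz : forall j, measurable_fun setT (z j).
Hypothesis zI : forall (J : {set 'I_d}) (B : 'I_d -> set R),
  (forall j, measurable (B j)) ->
  (P (\bigcap_(j in [set` J]) z j @^-1` B j) = \prod_(j in J) P (z j @^-1` B j))%E.

(** Rectangles form a pi-system; the coordinate preimages that generate [sigma_of] do not, since
    intersecting two coordinates leaves the family. *)
Definition cylinder (u : {set 'I_d}) : set (set T) :=
  [set A | exists2 B : 'I_d -> set R, (forall j, measurable (B j)) &
     A = \bigcap_(j in [set` u]) z j @^-1` B j].

Lemma cylinder_measurable u : cylinder u `<=` measurable.
Proof.
move=> _ [B mB ->]; apply: fin_bigcap_measurable => // j _.
by rewrite -[X in measurable X]setTI; exact: mz.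
Qed.

Lemma cylinder_setI u : setI_closed (cylinder u).
Proof.
move=> _ _ [A mA ->] [B mB ->]; exists (fun j => A j `&` B j).
  by move=> j; exact: measurableI.
by rewrite -bigcapI.
Qed.

Lemma cylinder_setT u : cylinder u setT.
Proof.
exists (fun=> setT) => //; apply/esym; rewrite -subTset => w _ j _ //.
Qed.

Lemma sigma_of_cylinder u : sigma_of z u `<=` <<s cylinder u >>.
Proof.
apply: smallest_sub; first exact: smallest_sigma_algebra.
move=> _ [j ju [B mB <-]]; apply: sub_sigma_algebra.
exists (fun i => if i == j then B else setT); first by move=> i; case: ifP.
rewrite setTI; apply/seteqP; split => [w wB i _ /=|w /(_ j ju)]; last by rewrite eqxx.
by case: ifPn => [/eqP ->|].
Qed.

Lemma sigma_of_sub_measurable u : sigma_of z u `<=` measurable.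
Proof.
apply: smallest_sub; first exact: sigma_algebra_measurable.
by move=> _ [j ju [B mB <-]]; exact: mz.
Qed.

Lemma sigma_ofS (u v : {set 'I_d}) : u \subset v -> sigma_of z u `<=` sigma_of z v.
Proof.
move=> uv; apply: smallest_sub; first exact: smallest_sigma_algebra.
move=> A [j ju jA]; apply: sub_sigma_algebra; exists j => //=.
exact: (fintype.subsetP uv).
Qed.

(** The pi-system extension runs once per argument. For two rectangles, disjointness of [u] and [v]
    lets the two families of sides be glued into one, to which [zI] applies. *)
Lemma indep_sigma_of (u v : {set 'I_d}) A B : [disjoint u & v]%B ->
  sigma_of z u A -> sigma_of z v B -> (P (A `&` B) = P A * P B)%E.
Proof.
move=> uv uA vB.
have vmB := sigma_of_sub_measurable vB.
rewrite muleC; apply: (@indep_sigma_ext (cylinder u)) => //.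
- exact: cylinder_measurable.
- exact: cylinder_setI.
- exact: cylinder_setT.
- move=> {uA}A uA; have mA := cylinder_measurable uA.
  rewrite setIC muleC; apply: (@indep_sigma_ext (cylinder v)) => //.
  + exact: cylinder_measurable.
  + exact: cylinder_setI.
  + exact: cylinder_setT.
  + move: uA => [A' mA' ->] _ [B' mB' ->].
    pose C j := if j \in u then A' j else B' j.
    have uC : {in u, C =1 A'} by move=> j ju; rewrite /C ju.
    have vC : {in v, C =1 B'}.
      by move=> j jv; rewrite /C (disjointFl uv jv).
    have -> : \bigcap_(j in [set` v]) z j @^-1` B' j `&`
              \bigcap_(j in [set` u]) z j @^-1` A' j =
              \bigcap_(j in [set` u :|: v]) z j @^-1` C j.
      rewrite setIC; apply/seteqP; split => [w [wA wB] j /=|w wC].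
        rewrite inE => /orP[ju|jv]; first by rewrite (uC _ ju); exact: wA.
        by rewrite (vC _ jv); exact: wB.
      by split => j /= jw; have := wC j; rewrite /= inE jw ?orbT => /(_ isT);
        rewrite ?(uC _ jw) ?(vC _ jw).
    rewrite !zI//; last by move=> j; rewrite /C; case: ifP.
    rewrite (eq_bigl [predU u & v]); last by move=> j; rewrite !inE.
    by rewrite bigU//; congr (_ * _)%E; apply: eq_bigr => j jw;
      rewrite ?(uC _ jw) ?(vC _ jw).
  + exact: sigma_of_cylinder.
- exact: sigma_of_cylinder.
Qed.

(** A copy of [T] carrying the sigma-algebra of the coordinates in [u], so that measurability with
    respect to it is an ordinary [measurable_fun] with all its closure lemmas. *)
Definition gen_type (u : {set 'I_d}) : Type :=
  g_sigma_algebraType (\bigcup_(j in [set` u]) preimage_set_system setT (z j) measurable).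
HB.instance Definition _ u := Measurable.on (gen_type u).

Definition gen_measurable {d'} {Y : measurableType d'} (u : {set 'I_d}) (f : T -> Y) :=
  measurable_fun (setT : set (gen_type u)) (f : gen_type u -> Y).

Lemma gen_measurableP {d'} {Y : measurableType d'} u (f : T -> Y) :
  gen_measurable u f <-> forall B, measurable B -> sigma_of z u (f @^-1` B).
Proof.
split => [mf B mB|mf _ B mB]; last by rewrite setTI; exact: mf.
by rewrite -[X in sigma_of z u X]setTI; exact: mf.
Qed.

Lemma gen_measurableT {d'} {Y : measurableType d'} u (f : T -> Y) :
  gen_measurable u f -> measurable_fun setT f.
Proof.
move=> /gen_measurableP mf _ B mB; rewrite setTI.
by apply: (@sigma_of_sub_measurable u); exact: mf.
Qed.

Lemma gen_measurableS {d'} {Y : measurableType d'} (u v : {set 'I_d}) (f : T -> Y) :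
  u \subset v -> gen_measurable u f -> gen_measurable v f.
Proof.
move=> uv /gen_measurableP mf; apply/gen_measurableP => B mB.
by apply: (sigma_ofS uv); exact: mf.
Qed.

Lemma gen_measurable_coord (u : {set 'I_d}) j : j \in u -> gen_measurable u (z j).
Proof.
move=> ju; apply/gen_measurableP => B mB; apply: sub_sigma_algebra.
by exists j => //; exists B => //; rewrite setTI.
Qed.

Lemma gen_measurable_sum (u v : {set 'I_d}) : v \subset u ->
  gen_measurable u (fun w => \sum_(j in v) z j w).
Proof.
move=> vu; rewrite /gen_measurable.
have -> : (fun w => \sum_(j in v) z j w) =
    (fun w => \sum_j if j \in v then z j w else 0).
  by apply/funext => w; rewrite big_mkcond.
apply: (@measurable_sum _ (gen_type u) R setT _ _
  (fun j w => if j \in v then z j w else 0)) => j.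
case jv: (j \in v); last exact: measurable_cst.
by apply: gen_measurable_coord; exact: (fintype.subsetP vu).
Qed.

Lemma indep_decouple {d1 d2} {Y1 : measurableType d1} {Y2 : measurableType d2}
    (u v : {set 'I_d}) (phi : T -> Y1) (psi : T -> Y2) (k : Y1 * Y2 -> \bar R) :
  [disjoint u & v]%B -> gen_measurable u phi -> gen_measurable v psi ->
  measurable_fun setT k -> (forall y, 0 <= k y)%E ->
  (\int[P]_w k (phi w, psi w) = \int[P]_w \int[P]_t k (phi w, psi t))%E.
Proof.
move=> uv uphi vpsi mk k0; apply: ge0_integral_decouple => //.
- exact: gen_measurableT uphi.
- exact: gen_measurableT vpsi.
- move=> A B mA mB; apply: (indep_sigma_of uv).
    by move/gen_measurableP: uphi; exact.
  by move/gen_measurableP: vpsi; exact.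
Qed.

Lemma ge0_indep_prod (u v : {set 'I_d}) (X Y : T -> \bar R) : [disjoint u & v]%B ->
  gen_measurable u X -> gen_measurable v Y -> (forall w, 0 <= X w)%E -> (forall w, 0 <= Y w)%E ->
  (\int[P]_w (X w * Y w) = \int[P]_w X w * \int[P]_w Y w)%E.
Proof.
move=> uv uX vY X0 Y0.
(* The kernel must be nonnegative on the whole value space, hence the absolute values; they change
   nothing on the nonnegative [X] and [Y]. *)
have := @indep_decouple _ _ _ _ u v X Y (fun y => `|y.1| * `|y.2|)%E uv uX vY.
have -> : (\int[P]_w (X w * Y w) = \int[P]_w (`|X w| * `|Y w|))%E.
  by apply: eq_integral => w _; rewrite !gee0_abs.
move=> /= ->; last 2 first.
- by apply: emeasurable_funM; apply: measurableT_comp.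
- by move=> y; rewrite mule_ge0.
under eq_integral => w _.
  rewrite (gee0_abs (X0 w)).
  under eq_integral => t _ do rewrite (gee0_abs (Y0 t)).
  rewrite ge0_integralZl//; last exact: gen_measurableT vY.
  over.
rewrite ge0_integralZr//; first exact: gen_measurableT uX.
exact: integral_ge0.
Qed.

End independence.

(** * Expectations of real random variables *)

Section real_expectation.
Context {dT : measure_display} {T : measurableType dT} {R : realType}.
Variable P : probability T R.
Implicit Types (X Y : T -> R).

(** [fine] sends infinite values to 0, so the algebraic rules for [Ex] carry [intg] hypotheses. *)
Definition Ex X : R := fine (\int[P]_w (X w)%:E)%E.

Definition intg X := P.-integrable setT (EFin \o X).

Definition sqint X := measurable_fun setT X /\ intg (fun w => X w ^+ 2).

Lemma fine_expectation X : fine 'E_P[X] = Ex X.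
Proof. by rewrite unlock. Qed.

Lemma intg_measurable X : intg X -> measurable_fun setT X.
Proof. by move/measurable_int/measurable_EFinP. Qed.

Lemma Ex_fin X : intg X -> (\int[P]_w (X w)%:E = (Ex X)%:E)%E.
Proof. by move=> iX; rewrite /Ex fineK//; exact: integrable_fin_num iX. Qed.

Lemma intg_cst c : intg (fun=> c).
Proof. by rewrite /intg; apply: finite_measure_integrable_cst. Qed.

Lemma Ex_cst c : Ex (fun=> c) = c.
Proof. by rewrite -fine_expectation (expectation_cst P c). Qed.

Lemma intgD X Y : intg X -> intg Y -> intg (fun w => X w + Y w).
Proof. exact: (@integrableD _ _ _ _ _ measurableT). Qed.

Lemma ExD X Y : intg X -> intg Y -> Ex (fun w => X w + Y w) = Ex X + Ex Y.
Proof.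
move=> iX iY; apply: EFin_inj; rewrite EFinD -!Ex_fin//; last exact: intgD.
by rewrite -(integralD_EFin _ iX iY).
Qed.

Lemma intgZ c X : intg X -> intg (fun w => c * X w).
Proof. by move=> iX; exact: (integrableZl measurableT c iX). Qed.

Lemma ExZ c X : intg X -> Ex (fun w => c * X w) = c * Ex X.
Proof.
move=> iX; apply: EFin_inj; rewrite EFinM -!Ex_fin//; last exact: intgZ.
by rewrite -(integralZl _ iX).
Qed.

Lemma intgN X : intg X -> intg (fun w => - X w).
Proof. by move=> /(intgZ (-1)); under eq_fun do rewrite mulN1r. Qed.

Lemma ExN X : intg X -> Ex (fun w => - X w) = - Ex X.
Proof. by move=> /(ExZ (-1)); under eq_fun do rewrite mulN1r; rewrite mulN1r. Qed.

Lemma intgB X Y : intg X -> intg Y -> intg (fun w => X w - Y w).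
Proof. by move=> iX iY; apply: intgD => //; exact: intgN. Qed.

Lemma ExB X Y : intg X -> intg Y -> Ex (fun w => X w - Y w) = Ex X - Ex Y.
Proof. by move=> iX iY; rewrite ExD ?ExN//; exact: intgN. Qed.

Lemma intg_Ex_sum (I : finType) (J : pred I) (X : I -> T -> R) :
  (forall i, J i -> intg (X i)) -> intg (fun w => \sum_(i | J i) X i w) /\
  Ex (fun w => \sum_(i | J i) X i w) = \sum_(i | J i) Ex (X i).
Proof.
move=> iX; elim: (index_enum I) => [|i s [IH1 IH2]].
  rewrite big_nil (_ : (fun w => _) = fun=> 0).
    by rewrite Ex_cst; split => //; exact: intg_cst.
  by apply/funext => w; rewrite big_nil.
have [Ji|Ji] := boolP (J i).
  rewrite big_cons Ji (_ : (fun w => _) = fun w => X i w + \sum_(j <- s | J j) X j w).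
    by rewrite ExD ?IH2//; [split => //; apply: intgD => //|]; exact: iX.
  by apply/funext => w; rewrite big_cons Ji.
rewrite big_cons (negbTE Ji) (_ : (fun w => _) = fun w => \sum_(j <- s | J j) X j w)//.
by apply/funext => w; rewrite big_cons (negbTE Ji).
Qed.

Lemma intg_sum (I : finType) (J : pred I) (X : I -> T -> R) :
  (forall i, J i -> intg (X i)) -> intg (fun w => \sum_(i | J i) X i w).
Proof. by case/intg_Ex_sum. Qed.

Lemma Ex_sum (I : finType) (J : pred I) (X : I -> T -> R) :
  (forall i, J i -> intg (X i)) ->
  Ex (fun w => \sum_(i | J i) X i w) = \sum_(i | J i) Ex (X i).
Proof. by case/intg_Ex_sum. Qed.

Lemma intg_ae X Y : measurable_fun setT X -> intg Y -> {ae P, forall w, X w = Y w} -> intg X.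
Proof.
move=> mX iY XY; apply/integrableP; split; first exact/measurable_EFinP.
rewrite (ae_eq_integral (fun w => `|(Y w)%:E|)%E)//.
- by case/integrableP: iY.
- by apply: measurableT_comp => //; exact/measurable_EFinP.
- by apply: measurableT_comp => //; exact: measurable_int iY.
- by apply: filterS XY => w /= -> _.
Qed.

Lemma Ex_ae X Y : measurable_fun setT X -> measurable_fun setT Y ->
  {ae P, forall w, X w = Y w} -> Ex X = Ex Y.
Proof.
move=> mX mY XY; congr fine; apply: ae_eq_integral => //; try exact/measurable_EFinP.
by apply: filterS XY => w /= -> _.
Qed.

Lemma intg_lty X : measurable_fun setT X -> (forall w, 0 <= X w) ->
  (\int[P]_w (X w)%:E < +oo)%E -> intg X.
Proof.
move=> mX X0 fX; apply/integrableP; split; first exact/measurable_EFinP.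
by under eq_integral => w _ do rewrite gee0_abs ?lee_fin//.
Qed.

Lemma intg_dom X Y : measurable_fun setT X -> intg Y ->
  {ae P, forall w, `|X w| <= Y w} -> intg X.
Proof.
move=> mX iY XY; apply/integrableP; split; first exact/measurable_EFinP.
case/integrableP: (iY) => mY; apply: le_lt_trans.
apply: ae_ge0_le_integral => //.
- by apply: measurableT_comp => //; exact/measurable_EFinP.
- by apply: measurableT_comp.
- by apply: filterS XY => w /= h _; rewrite lee_fin (le_trans h)// ler_norm.
Qed.

Lemma Ex_ge0 X : (forall w, 0 <= X w) -> 0 <= Ex X.
Proof. by move=> X0; apply: fine_ge0; apply: integral_ge0 => w _; rewrite lee_fin. Qed.

Lemma Ex_le X Y : intg X -> intg Y -> {ae P, forall w, X w <= Y w} -> Ex X <= Ex Y.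
Proof.
move=> iX iY XY; rewrite -subr_ge0 -ExB//.
(* [Ex_ge0] wants a pointwise inequality, while this one holds almost everywhere; truncation at 0
   repairs it on a null set. *)
rewrite (@Ex_ae _ (fun w => Num.max (Y w - X w) 0)).
- by apply: Ex_ge0 => w; rewrite le_max lexx orbT.
- by apply: intg_measurable; exact: intgB.
- by apply: measurable_maxr => //; apply: intg_measurable; exact: intgB.
- by apply: filterS XY => w /= h; rewrite max_l// subr_ge0.
Qed.

Lemma intgM X Y : sqint X -> sqint Y -> intg (fun w => X w * Y w).
Proof.
move=> [mX iX] [mY iY]; apply: (intg_dom _ (intgD iX iY)).
  exact: measurable_funM.
by apply: aeW => w; rewrite ler_norml; apply/andP; split; nra.
Qed.

Lemma sqint_cst c : sqint (fun=> c).
Proof. by split; [exact: measurable_cst|exact: intg_cst]. Qed.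

Lemma sqint_intg X : sqint X -> intg X.
Proof. by move=> /intgM/(_ (sqint_cst 1)); under eq_fun do rewrite mulr1. Qed.

Lemma sqint_dom X Y : measurable_fun setT X -> intg Y ->
  {ae P, forall w, X w ^+ 2 <= Y w} -> sqint X.
Proof.
move=> mX iY XY; split => //; apply: (intg_dom _ iY); first exact: measurable_funX.
by apply: filterS XY => w /=; rewrite ger0_norm// sqr_ge0.
Qed.

Lemma sqintD X Y : sqint X -> sqint Y -> sqint (fun w => X w + Y w).
Proof.
move=> [mX iX] [mY iY]; apply: (@sqint_dom _ (fun w => 2 * (X w ^+ 2 + Y w ^+ 2))).
- exact: measurable_funD.
- by apply: intgZ; exact: intgD.
- by apply: aeW => w /=; have := sqr_ge0 (X w - Y w); nra.
Qed.

Lemma sqintZ c X : sqint X -> sqint (fun w => c * X w).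
Proof.
move=> [mX iX]; split; first exact: measurable_funM.
by under eq_fun do rewrite exprMn; exact: intgZ.
Qed.

Lemma sqintN X : sqint X -> sqint (fun w => - X w).
Proof. by move=> /(sqintZ (-1)); under eq_fun do rewrite mulN1r. Qed.

Lemma sqintB X Y : sqint X -> sqint Y -> sqint (fun w => X w - Y w).
Proof. by move=> sX sY; apply: sqintD => //; exact: sqintN. Qed.

Lemma sqint_sum (I : finType) (J : pred I) (X : I -> T -> R) :
  (forall i, J i -> sqint (X i)) -> sqint (fun w => \sum_(i | J i) X i w).
Proof.
move=> sX; elim: (index_enum I) => [|i s IH].
  rewrite (_ : (fun w => _) = fun=> 0); first exact: sqint_cst.
  by apply/funext => w; rewrite big_nil.
have [Ji|Ji] := boolP (J i).
  rewrite (_ : (fun w => _) = fun w => X i w + \sum_(j <- s | J j) X j w).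
    by apply: sqintD => //; exact: sX.
  by apply/funext => w; rewrite big_cons Ji.
rewrite (_ : (fun w => _) = fun w => \sum_(j <- s | J j) X j w)//.
by apply/funext => w; rewrite big_cons (negbTE Ji).
Qed.

Lemma Ex_sqr_ge0 X : 0 <= Ex (fun w => X w ^+ 2).
Proof. by apply: Ex_ge0 => w; exact: sqr_ge0. Qed.

Lemma sqint_Lfun X : sqint X <-> X \in Lfun P 2%:E.
Proof.
split => [[mX iX]|LX]; last first.
  split; last exact: Lfun2_integrable_sqr.
  by move/sub_Lfun_mfun: LX; rewrite inE.
rewrite inE; apply/andP; split; rewrite inE//=.
rewrite /finite_norm unlock; apply: poweR_lty.
case/integrableP: iX => _; congr (_ < _)%E; apply: eq_integral => w _ /=.
by rewrite normrX powR_mulrn.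
Qed.

Lemma variance_Ex X : sqint X -> 'V_P[X] = (Ex (fun w => X w ^+ 2) - Ex X ^+ 2)%:E.
Proof.
move=> sX; rewrite varianceE; last exact/sqint_Lfun.
rewrite [in X in (X - _)%E]unlock [in X in (_ - X)%E]unlock.
have -> : (\int[P]_w (X w)%:E = (Ex X)%:E)%E by exact/Ex_fin/sqint_intg.
have -> : (\int[P]_w ((X ^+ 2)%R w)%:E = (Ex (fun w => X w ^+ 2)%R)%:E)%E.
  by rewrite -Ex_fin//; case: sX.
by rewrite EFinB.
Qed.

Lemma ge0_Ex_prod X Y : (forall w, 0 <= X w) -> (forall w, 0 <= Y w) ->
  intg X -> intg Y ->
  (\int[P]_w ((X w)%:E * (Y w)%:E) = \int[P]_w (X w)%:E * \int[P]_w (Y w)%:E)%E ->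
  intg (fun w => X w * Y w) /\ Ex (fun w => X w * Y w) = Ex X * Ex Y.
Proof.
move=> X0 Y0 iX iY XY.
have E : (\int[P]_w (X w * Y w)%:E = (Ex X * Ex Y)%:E)%E.
  by rewrite EFinM -!Ex_fin// -XY; apply: eq_integral => w _; rewrite EFinM.
have iXY : intg (fun w => X w * Y w).
  apply: intg_lty; last by rewrite E ltry.
  - by apply: measurable_funM; exact: intg_measurable.
  - by move=> w; exact: mulr_ge0.
by split => //; apply: EFin_inj; rewrite -E Ex_fin.
Qed.

Variables (d : nat) (z : 'I_d -> T -> R).
Hypothesis mz : forall j, measurable_fun setT (z j).
Hypothesis zI : forall (J : {set 'I_d}) (B : 'I_d -> set R),
  (forall j, measurable (B j)) ->
  (P (\bigcap_(j in [set` J]) z j @^-1` B j) = \prod_(j in J) P (z j @^-1` B j))%E.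

(** Decoupling covers nonnegative factors only. Positive and negative parts stay measurable for the
    same coordinates, which reduces the claim to four nonnegative products. *)
Lemma indep_intg_prod (u v : {set 'I_d}) X Y : [disjoint u & v]%B ->
  gen_measurable z u X -> gen_measurable z v Y -> intg X -> intg Y ->
  intg (fun w => X w * Y w) /\ Ex (fun w => X w * Y w) = Ex X * Ex Y.
Proof.
move=> uv uX vY iX iY.
have pos (f : T -> R) s : gen_measurable z s f -> intg f ->
    [/\ gen_measurable z s (fun w => Num.max (f w) 0), intg (fun w => Num.max (f w) 0),
        gen_measurable z s (fun w => Num.max (- f w) 0) & intg (fun w => Num.max (- f w) 0)].
  move=> sf i.
  have s1 : gen_measurable z s (fun w => Num.max (f w) 0) by exact: measurable_maxr.
  have s2 : gen_measurable z s (fun w => Num.max (- f w) 0).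
    by apply: measurable_maxr => //; exact: measurableT_comp.
  have ni : intg (fun w => `|f w|).
    apply: (intg_dom _ (intgD (integrable_norm i) (intg_cst 0))).
      by apply: measurableT_comp => //; exact: intg_measurable.
    by apply: aeW => w; rewrite normr_id addr0.
  split => //.
    apply: (intg_dom _ ni); first exact: (gen_measurableT mz s1).
    by apply: aeW => w; case: (lerP 0 (f w)) => h; rewrite ?normr0// ger0_norm// ler_norm.
  apply: (intg_dom _ ni); first exact: (gen_measurableT mz s2).
  apply: aeW => w; case: (lerP 0 (- f w)) => h; rewrite ?normr0//.
  by rewrite ger0_norm// -normrN ler_norm.
have split_ (f : T -> R) w : f w = Num.max (f w) 0 - Num.max (- f w) 0.
  by case: (lerP 0 (f w)) => h; case: (lerP 0 (- f w)) => h'; lra.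
have m0 (f : T -> R) w : 0 <= Num.max (f w) 0 by rewrite le_max lexx orbT.
have [uX1 iX1 uX2 iX2] := pos _ _ uX iX.
have [vY1 iY1 vY2 iY2] := pos _ _ vY iY.
have E (f g : T -> R) : gen_measurable z u f -> gen_measurable z v g -> (forall w, 0 <= f w) ->
    (forall w, 0 <= g w) -> intg f -> intg g ->
    intg (fun w => f w * g w) /\ Ex (fun w => f w * g w) = Ex f * Ex g.
  move=> uf vg f0 g0 i1 i2; apply: ge0_Ex_prod => //.
  apply: (ge0_indep_prod mz zI uv) => //; exact/measurable_EFinP.
have [i11 E11] := E _ _ uX1 vY1 (m0 _) (m0 _) iX1 iY1.
have [i12 E12] := E _ _ uX1 vY2 (m0 _) (m0 (fun w => - Y w)) iX1 iY2.
have [i21 E21] := E _ _ uX2 vY1 (m0 (fun w => - X w)) (m0 _) iX2 iY1.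
have [i22 E22] := E _ _ uX2 vY2 (m0 (fun w => - X w)) (m0 (fun w => - Y w)) iX2 iY2.
have XE : Ex X = Ex (fun w => Num.max (X w) 0) - Ex (fun w => Num.max (- X w) 0).
  by rewrite -ExB//; congr Ex; apply/funext.
have YE : Ex Y = Ex (fun w => Num.max (Y w) 0) - Ex (fun w => Num.max (- Y w) 0).
  by rewrite -ExB//; congr Ex; apply/funext.
have -> : (fun w => X w * Y w) = fun w =>
    (Num.max (X w) 0 * Num.max (Y w) 0 - Num.max (X w) 0 * Num.max (- Y w) 0) -
    (Num.max (- X w) 0 * Num.max (Y w) 0 - Num.max (- X w) 0 * Num.max (- Y w) 0).
  by apply/funext => w; rewrite [in LHS](split_ X) [in LHS](split_ Y); ring.
split; first by apply: intgB; exact: intgB.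
rewrite !ExB//; try exact: intgB.
by rewrite E11 E12 E21 E22 XE YE; ring.
Qed.

End real_expectation.

(** * Inequalities for powers *)

Section power_inequalities.
Context {R : realType}.
Implicit Types (p q r x y a b : R).

(** The endpoints come in either order because a coordinate may lie on either side of its mean. *)
Lemma MVT_pos (f df : R -> R) a b :
  (forall x, 0 < x -> is_derive x 1 f (df x)) -> 0 < a -> 0 < b ->
  exists c, [/\ 0 < c, Num.min a b <= c <= Num.max a b & f b - f a = df c * (b - a)].
Proof.
move=> fdf.
have main a' b' : 0 < a' -> a' < b' ->
    exists c, [/\ 0 < c, a' <= c <= b' & f b' - f a' = df c * (b' - a')].
  move=> a0 ab.
  have gt0 x : a' <= x -> 0 < x by exact: lt_le_trans.
  have [||c] := @MVT R f df a' b' ab.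
  - by move=> x; rewrite in_itv/= => /andP[/ltW ax _]; apply: fdf; exact: gt0.
  - apply: derivable_within_continuous => x; rewrite in_itv/= => /andP[ax _].
    by case: (fdf x (gt0 _ ax)).
  - rewrite in_itv/= => /andP[ac cb] E; exists c; split => //; last by rewrite !ltW.
    by apply: gt0; exact: ltW.
move=> a0 b0; have [ab|ba|<-] := ltgtP a b.
- by have [c [c0 acb E]] := main _ _ a0 ab; exists c; split.
- have [c [c0 acb E]] := main _ _ b0 ba; exists c; split => //.
  by apply: oppr_inj; rewrite opprB E -mulrN opprB.
- by exists a; split => //; [rewrite lexx|rewrite !subrr mulr0].
Qed.

Lemma is_derive1_powR_shift s p x : 0 < x + s ->
  is_derive x 1 (fun t => (t + s) `^ p) (p * (x + s) `^ (p - 1)).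
Proof.
move=> xs; rewrite -[X in is_derive _ _ _ X]mulr1.
by apply: (@is_derive1_comp R (fun t => t `^ p) (shift s));
  [exact: is_derive1_powR|exact: is_derive_shift].
Qed.

Lemma powR_MVT p x y : 0 < x -> 0 < y ->
  exists c, [/\ 0 < c, Num.min x y <= c <= Num.max x y &
    y `^ p - x `^ p = p * c `^ (p - 1) * (y - x)].
Proof. by apply: MVT_pos => t t0; exact: is_derive1_powR. Qed.

Lemma ler_powR_neg r x y : r <= 0 -> 0 < x -> x <= y -> y `^ r <= x `^ r.
Proof.
move=> r0 x0 xy; rewrite -(opprK r) powRN (powRN x).
have y0 : 0 < y by exact: lt_le_trans xy.
rewrite lef_pV2 ?posrE ?powR_gt0//; apply: ge0_ler_powR => //; rewrite ?nnegrE ?oppr_ge0//.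
all: exact: ltW.
Qed.

Lemma powR_ge1_neg r x : r <= 0 -> 0 < x -> x <= 1 -> 1 <= x `^ r.
Proof. by move=> r0 x0 x1; have := ler_powR_neg r0 x0 x1; rewrite powR1. Qed.

Lemma powR_le1_neg r x : r <= 0 -> 1 <= x -> x `^ r <= 1.
Proof. by move=> r0 x1; have := ler_powR_neg r0 ltr01 x1; rewrite powR1. Qed.

(** The mean value theorem in each of the two variables gives p (p - 1) (a - m) (b - n) times the
    power p - 2 of some point above [A]; as p - 2 is negative, moving that point down to [A] only
    increases the square. In the application [A] is independent of the other factors. *)
Lemma powR_second_difference p A a b m n : p < 1 ->
  0 < A -> 0 < a -> 0 < b -> 0 < m -> 0 < n ->
  ((A + a + b) `^ p - (A + m + b) `^ p - (A + a + n) `^ p + (A + m + n) `^ p) ^+ 2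
    <= p ^+ 2 * (p - 1) ^+ 2 * (a - m) ^+ 2 * (b - n) ^+ 2 * A `^ (2 * p - 4).
Proof.
move=> p1 A0 a0 b0 m0 n0.
have Ab : 0 < A + b by exact: addr_gt0.
have An : 0 < A + n by exact: addr_gt0.
pose f t := (t + (A + b)) `^ p - (t + (A + n)) `^ p.
have [x x0|c [c0 _ E]] := @MVT_pos f
    (fun t => p * (t + (A + b)) `^ (p - 1) - p * (t + (A + n)) `^ (p - 1)) m a _ m0 a0.
  by apply: is_deriveB; apply: is_derive1_powR_shift; exact: addr_gt0.
have [x x0|c' [c'0 _ E']] := @MVT_pos (fun t => (t + (A + c)) `^ (p - 1))
    (fun t => (p - 1) * (t + (A + c)) `^ (p - 1 - 1)) n b _ n0 b0.
  by apply: is_derive1_powR_shift; rewrite !addr_gt0.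
have -> : (A + a + b) `^ p - (A + m + b) `^ p - (A + a + n) `^ p + (A + m + n) `^ p
    = f a - f m.
  rewrite /f (_ : a + (A + b) = A + a + b); last by ring.
  rewrite (_ : a + (A + n) = A + a + n); last by ring.
  rewrite (_ : m + (A + b) = A + m + b); last by ring.
  rewrite (_ : m + (A + n) = A + m + n); last by ring.
  by ring.
rewrite E (_ : c + (A + b) = b + (A + c)); last by ring.
rewrite (_ : c + (A + n) = n + (A + c)); last by ring.
rewrite -mulrBr E'.
set B := c' + (A + c).
have AB : A <= B by rewrite /B; lra.
have BA : B `^ (p - 1 - 1) <= A `^ (p - 2).
  rewrite (_ : p - 1 - 1 = p - 2); last by ring.
  by apply: ler_powR_neg => //; lra.
have -> : A `^ (2 * p - 4) = A `^ (p - 2) ^+ 2.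
  rewrite -powR_mulrn ?powR_ge0// -powRrM; congr (_ `^ _); ring.
have -> : (p * ((p - 1) * B `^ (p - 1 - 1) * (b - n)) * (a - m)) ^+ 2 =
  p ^+ 2 * (p - 1) ^+ 2 * (a - m) ^+ 2 * (b - n) ^+ 2 * B `^ (p - 1 - 1) ^+ 2 by ring.
apply: ler_wpM2l; first by rewrite -!exprMn sqr_ge0.
by rewrite ler_pXn2r// ?nnegrE ?powR_ge0.
Qed.

Lemma powR_bernoulli_neg r x : r <= 0 -> 0 < x -> 1 + r * (x - 1) <= x `^ r.
Proof.
move=> r0 x0; have [c [c0 /andP[cm cM]]] := @powR_MVT r 1 x ltr01 x0.
rewrite powR1 => E.
suff : r * (x - 1) <= r * c `^ (r - 1) * (x - 1) by lra.
have [x1|x1] := leP 1 x.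
- have : c `^ (r - 1) <= 1.
    by apply: powR_le1_neg; [lra|move: cm; rewrite min_l].
  set k := c `^ _ => k1.
  have rk : 0 <= r * (k - 1) by nra.
  have := mulr_ge0 rk (eqbRL (subr_ge0 1 x) x1); lra.
- have : 1 <= c `^ (r - 1).
    by apply: powR_ge1_neg => //; [lra|move: cM; rewrite max_l// ltW].
  set k := c `^ _ => k1.
  have rk : 0 <= r * (1 - k) by nra.
  have x1' : 0 <= 1 - x by lra.
  have := mulr_ge0 rk x1'; lra.
Qed.

Lemma powR_bernoulli r x : 0 <= r -> r <= 1 -> 0 < x -> x `^ r <= 1 + r * (x - 1).
Proof.
move=> r0 r1 x0; have [c [c0 /andP[cm cM]]] := @powR_MVT r 1 x ltr01 x0.
rewrite powR1 => E.
suff : r * c `^ (r - 1) * (x - 1) <= r * (x - 1) by lra.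
have [x1|x1] := leP 1 x.
- have : c `^ (r - 1) <= 1.
    by apply: powR_le1_neg; [lra|move: cm; rewrite min_l].
  have := powR_ge0 c (r - 1) => h1 h2.
  rewrite ler_wpM2r ?subr_ge0//; nra.
- have : 1 <= c `^ (r - 1).
    by apply: powR_ge1_neg => //; [lra|move: cM; rewrite max_l// ltW].
  move=> h; rewrite ler_wnM2r; [by []|lra|nra].
Qed.

(** Applying the mean value theorem twice yields a second-order remainder with the power - q - 2 of
    a point between 1 and [y]. That power is at most its value at whichever endpoint is smaller,
    hence at most the sum of both. The factor 1/2 of Taylor's formula is given up. *)
Lemma powR_taylor_neg q y : 0 < q -> 0 < y ->
  y `^ (- q) <= 1 - q * (y - 1) + q * (q + 1) * ((y - 1) ^+ 2 * (1 + y `^ (- q - 2))).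
Proof.
move=> q0 y0; have [c [c0 /andP[cm cM]]] := @powR_MVT (- q) 1 y ltr01 y0.
rewrite powR1 => E.
have [e [e0 /andP[em eM]]] := @powR_MVT (- q - 1) 1 c ltr01 c0.
rewrite powR1 => E'.
have eB : e `^ (- q - 1 - 1) <= 1 + y `^ (- q - 2).
  rewrite (_ : - q - 1 - 1 = - q - 2); last by ring.
  have /orP[e1|ye] : (1 <= e) || (y <= e).
    by move: em cm; rewrite !ge_min => /orP[->//|ce] /orP[c1|yc];
      [rewrite (le_trans c1)|rewrite (le_trans yc) ?orbT].
  - have := powR_ge0 y (- q - 2).
    have : e `^ (- q - 2) <= 1 by apply: powR_le1_neg => //; lra.
    lra.
  - have : e `^ (- q - 2) <= y `^ (- q - 2) by apply: ler_powR_neg => //; lra.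
    lra.
have cy : 0 <= (c - 1) * (y - 1) <= (y - 1) ^+ 2.
  have [y1|y1] := leP 1 y.
  - by move: cm cM; rewrite min_l// max_r// => cm cM; apply/andP; split; nra.
  - by move: cm cM; rewrite (min_r (ltW y1)) (max_l (ltW y1)) => cm cM; apply/andP; split; nra.
have -> : y `^ (- q) = 1 - q * (y - 1) +
    q * (q + 1) * ((c - 1) * (y - 1) * e `^ (- q - 1 - 1)).
  transitivity (1 - q * (y - 1) - q * (c `^ (- q - 1) - 1) * (y - 1)); first by lra.
  by rewrite E'; ring.
rewrite lerD2l ler_wpM2l//; first by apply: mulr_ge0; lra.
case/andP: cy => cy0 cy1.
by apply: ler_pM => //; exact: powR_ge0.
Qed.

(** Subtract from the power its quadratic Taylor polynomial at 1 and divide by [p]: the derivative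
    of the result is nonnegative by the tangent inequality for the exponent p - 1. The result thus
    has the sign of x - 1, and multiplying by x - 1 removes the case distinction. The division
    treats both signs of [p] at once. *)
Lemma powR_centered_mul p x : p < 1 -> p != 0 -> 0 < x ->
  (x - 1) ^+ 2 + (p - 1) / 2 * (x - 1) ^+ 3 <= (x `^ p - 1) / p * (x - 1).
Proof.
move=> p1 p0 x0.
(* The shift by 0 matches the form of [is_derive1_powR_shift]. *)
pose f t := (t + 0) `^ p - p * (t - 1) - p * (p - 1) / 2 * ((t - 1) * (t - 1)).
pose df t := p * (t `^ (p - 1) - 1 - (p - 1) * (t - 1)).
have [t t0|c [c0 _ E]] := @MVT_pos f df 1 x _ ltr01 x0.
  have d1 : is_derive t (1 : R) (fun s => s - 1) 1 by exact: is_derive_shift.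
  have d2 : is_derive t (1 : R) (fun s => p * (s - 1)) p.
    by have := is_deriveZ p d1; rewrite /GRing.scale /= mulr1.
  have d3 : is_derive t (1 : R) (fun s => p * (p - 1) / 2 * ((s - 1) * (s - 1)))
      (p * (p - 1) * (t - 1)).
    have := is_deriveZ (p * (p - 1) / 2) (is_deriveM d1 d1); rewrite /GRing.scale /=.
    move=> h; refine (is_derive_eq h _).
    by rewrite /GRing.scale /=; field.
  have := is_deriveB (is_deriveB (@is_derive1_powR_shift 0 p t _) d2) d3.
  rewrite addr0 => /(_ t0) h; refine (is_derive_eq h _).
  by rewrite /df; ring.
have {E} : (x `^ p - 1) / p - (x - 1) - (p - 1) / 2 * (x - 1) ^+ 2 =
    (c `^ (p - 1) - 1 - (p - 1) * (c - 1)) * (x - 1).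
  apply: (mulfI p0); move: E; rewrite /f /df addr0 subrr.
  rewrite !mulr0 !subr0 addr0 powR1 => E.
  rewrite [RHS]mulrA -E; field; exact: p0.
have := @powR_bernoulli_neg (p - 1) c _ c0; rewrite subr_le0 => /(_ (ltW p1)) h E.
rewrite -subr_ge0.
have -> : (x `^ p - 1) / p * (x - 1) - ((x - 1) ^+ 2 + (p - 1) / 2 * (x - 1) ^+ 3) =
  ((x `^ p - 1) / p - (x - 1) - (p - 1) / 2 * (x - 1) ^+ 2) * (x - 1) by ring.
by rewrite E -mulrA -expr2 mulr_ge0 ?sqr_ge0//; lra.
Qed.

Lemma power_exponent_le0 p : p < 1 -> 2 * p - 4 <= 0.
Proof. by lra. Qed.

(** The exponent 2p lies between 2p - 4 and 2, and the moments of these two orders are the ones at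
    hand. *)
Lemma powR_sqr_bound p x : p < 1 -> 0 < x -> (x `^ p) ^+ 2 <= x ^+ 2 + x `^ (2 * p - 4).
Proof.
move=> p1 x0.
have -> : (x `^ p) ^+ 2 = x `^ (2 * p).
  by rewrite -powR_mulrn ?powR_ge0// -powRrM mulrC.
have [x1|x1] := leP 1 x.
- rewrite -(powR_mulrn 2 (ltW x0)).
  have : x `^ (2 * p) <= x `^ 2%:R by apply: ler_powR => //; lra.
  have := powR_ge0 x (2 * p - 4); lra.
- have : x `^ (2 * p) <= x `^ (2 * p - 4).
    by apply: ger_powR; [rewrite x0 ltW|lra].
  have := sqr_ge0 x; lra.
Qed.

Lemma powR_prod (I : finType) (J : {pred I}) (F : I -> R) r :
  (forall i, i \in J -> 0 <= F i) ->
  (\prod_(i in J) F i) `^ r = \prod_(i in J) F i `^ r.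
Proof.
move=> F0; suff : 0 <= \prod_(i in J) F i /\
  (\prod_(i in J) F i) `^ r = \prod_(i in J) F i `^ r by case.
apply: (big_ind2 (fun x y => 0 <= x /\ x `^ r = y)).
- by rewrite powR1.
- by move=> x1 x2 y1 y2 [x0 <-] [y0 <-]; rewrite mulr_ge0// powRM.
- by move=> i iJ; split => //; exact: F0.
Qed.

Lemma mean_powR_neg (I : finType) (J : {pred I}) (F : I -> R) r : 0 <= r ->
  (0 < #|J|)%N -> (forall i, i \in J -> 0 < F i) ->
  ((\sum_(i in J) F i) / #|J|%:R) `^ (- r) <= \prod_(i in J) F i `^ (- (r / #|J|%:R)).
Proof.
move=> r0 J0 F0.
have n0 : (0 : R) < #|J|%:R by rewrite ltr0n.
have FJ i : i \in J -> 0 <= F i by move=> iJ; rewrite ltW// F0.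
have [h _] := leif_AGM FJ.
have pr0 : 0 < \prod_(i in J) F i by exact: prodr_gt0.
rewrite -powR_prod//.
set mu := _ / _ in h *.
have mu0 : 0 <= mu by rewrite divr_ge0// sumr_ge0.
have -> : mu `^ (- r) = (mu ^+ #|J|) `^ (- (r / #|J|%:R)).
  rewrite -powR_mulrn// -powRrM; congr (_ `^ _); field.
  exact: lt0r_neq0.
by apply: ler_powR_neg => //; rewrite oppr_le0 divr_ge0// ltW.
Qed.

End power_inequalities.

(** * ANOVA decomposition of a function of a sum *)

Section anova_of_sum.
Context {dT : measure_display} {T : measurableType dT} {R : realType}.
Variable P : probability T R.
Variables (d : nat) (z : 'I_d -> T -> R).
Hypothesis mz : forall j, measurable_fun setT (z j).
Hypothesis zI : forall (J : {set 'I_d}) (B : 'I_d -> set R),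
  (forall j, measurable (B j)) ->
  (P (\bigcap_(j in [set` J]) z j @^-1` B j) = \prod_(j in J) P (z j @^-1` B j))%E.
Variables (f : ('I_d -> R) -> R) (H : R -> R).
Hypothesis mH : measurable_fun setT H.
(** Nonnegativity lets Tonelli perform all partial integrations before any finiteness is known. *)
Hypothesis H0 : forall x, 0 <= H x.
Hypothesis fE : forall x, f x = H (\sum_j x j).
Let fz (w : T) : R := f (fun j => z j w).
Hypothesis sF : sqint P fz.
Implicit Types (u v : {set 'I_d}).

(** * Explicit versions of the conditional expectations *)

Let S (u : {set 'I_d}) (w : T) : R := \sum_(j in u) z j w.

Let mS u : gen_measurable z u (S u).
Proof. exact: gen_measurable_sum. Qed.

Let mST u : measurable_fun setT (S u).
Proof. by have := gen_measurableT mz (@mS u). Qed.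

Let SU u v w : [disjoint u & v]%B -> S (u :|: v) w = S u w + S v w.
Proof.
move=> uv; rewrite /S (eq_bigl [predU u & v]); last by move=> j; rewrite !inE.
by rewrite bigU.
Qed.

(* By independence, integrating out the coordinates outside u while the partial sum over
   u is frozen at t gives a version of the conditional expectation. *)
Definition cond_sum u (t : R) : \bar R := (\int[P]_w (H (t + S (~: u) w))%:E)%E.

Let m_sum u : measurable_fun setT (fun y : R * T => (H (y.1 + S (~: u) y.2))%:E).
Proof.
apply/measurable_EFinP; apply: (measurableT_comp mH); apply: measurable_funD => //.
exact: (measurableT_comp (@mST _)).
Qed.

Lemma cond_sum_ge0 u t : (0 <= cond_sum u t)%E.
Proof. by apply: integral_ge0 => w _; rewrite lee_fin. Qed.

Lemma measurable_cond_sum u : measurable_fun setT (cond_sum u).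
Proof.
by apply: (@measurable_fun_fubini_tonelli_F _ _ _ _ _ P _ (@m_sum u)) => y; rewrite lee_fin.
Qed.

(** Tower property: the sums over [u :\: v] and over the complement of [u] are independent and add
    up to the sum over the complement of [v]. *)
Lemma cond_sum_disjoint u v t : v \subset u ->
  (\int[P]_w cond_sum u (t + S (u :\: v) w) = cond_sum v t)%E.
Proof.
move=> vu.
have dis : [disjoint u :\: v & ~: u]%B.
  by rewrite finset.disjoints_subset; apply/fintype.subsetP => j; rewrite !inE => /andP[_ ->].
have mk : measurable_fun setT (fun y : R * R => (H (t + y.1 + y.2))%:E).
  apply/measurable_EFinP; apply: (measurableT_comp mH); apply: measurable_funD => //.
  exact: measurable_funD.
have := @indep_decouple _ _ _ P d z mz zI _ _ _ _ _ _ (S (u :\: v)) (S (~: u))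
  (fun y : R * R => (H (t + y.1 + y.2))%:E) dis (@mS _) (@mS _) mk (fun y => H0 _).
move=> /= <-; rewrite /cond_sum; apply: eq_integral => w _.
congr (H _)%:E; rewrite -addrA -SU//; congr (_ + S _ w).
by apply/setP => j; rewrite !inE; case jv: (j \in v) => //=;
  [rewrite (fintype.subsetP vu)|case: (j \in u)].
Qed.

(** The source of all orthogonality below. With the coordinates in [v] held fixed, only those of [u]
    outside [v] are left to integrate in [cond_sum u], and the tower property reduces [u] to
    [u :&: v]. *)
Lemma cond_sum_project u v (q : T -> R) : gen_measurable z v q -> (forall w, 0 <= q w) ->
  (\int[P]_w (cond_sum u (S u w) * (q w)%:E) =
   \int[P]_w (cond_sum (u :&: v) (S (u :&: v) w) * (q w)%:E))%E.
Proof.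
move=> vq q0.
have dis : [disjoint v & u :\: (u :&: v)]%B.
  rewrite finset.disjoints_subset; apply/fintype.subsetP => j jv.
  by rewrite !inE jv andbT andNb.
have vp : gen_measurable z v (fun w => (S (u :&: v) w, q w)).
  apply: measurable_fun_pair => //.
  by apply: (@gen_measurableS _ _ _ _ _ _ _ (u :&: v)) => //; exact: subsetIr.
have mk : measurable_fun setT (fun y : (R * R) * R =>
    (cond_sum u (y.1.1 + y.2) * `|(y.1.2)%:E|)%E).
  apply: emeasurable_funM.
    apply: (measurableT_comp (@measurable_cond_sum u)); apply: measurable_funD => //.
    exact: (measurableT_comp measurable_fst measurable_fst).
  apply: measurableT_comp => //; apply/measurable_EFinP.
  exact: (measurableT_comp measurable_snd measurable_fst).
have k0 y : (0 <= (fun y : (R * R) * R =>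
    (cond_sum u (y.1.1 + y.2) * `|(y.1.2)%:E|)%E) y)%E.
  by rewrite mule_ge0// cond_sum_ge0.
have /= E := @indep_decouple _ _ _ P d z mz zI _ _ _ _ _ _
  (fun w => (S (u :&: v) w, q w)) (S (u :\: (u :&: v)))
  (fun y : (R * R) * R => (cond_sum u (y.1.1 + y.2) * `|(y.1.2)%:E|)%E) dis vp (@mS _) mk k0.
transitivity (\int[P]_w (cond_sum u (S (u :&: v) w + S (u :\: (u :&: v)) w) * `|(q w)%:E|))%E.
  apply: eq_integral => w _; rewrite gee0_abs ?lee_fin//; congr (cond_sum u _ * _)%E.
  rewrite -SU; last by rewrite disjoint_sym finset.disjoints_subset; apply/fintype.subsetP => j;
    rewrite !inE => /andP[].
  by congr (S _ w); apply/setP => j; rewrite !inE; case: (j \in u); case: (j \in v).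
rewrite E; apply: eq_integral => w _.
rewrite ge0_integralZr//.
- by rewrite cond_sum_disjoint ?subsetIl// ger0_norm.
- apply: (measurableT_comp (@measurable_cond_sum u)); apply: measurable_funD => //.
- by move=> t _; exact: cond_sum_ge0.
Qed.

Lemma cond_sumT w : cond_sum [set: 'I_d] (S [set: 'I_d] w) = (fz w)%:E.
Proof.
rewrite /cond_sum; transitivity (\int[P]__ (cst (fz w)%:E) w)%E; last first.
  by rewrite (integral_cst P measurableT)/= probability_setT mule1.
apply: eq_integral => t _ /=; rewrite finset.setCT /S big_set0 addr0 /fz fE.
by congr (H _)%:E; apply: eq_bigl => j; rewrite inE.
Qed.

(* [fine] changes the value only on the null set where [cond_sum] is infinite. *)
Definition cond_version u w : R := fine (cond_sum u (S u w)).

Lemma gen_measurable_cond_version u : gen_measurable z u (cond_version u).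
Proof.
apply: (measurableT_comp (f := fun t => fine (cond_sum u t))) => //.
  exact: (measurableT_comp _ (@measurable_cond_sum u)).
exact: mS.
Qed.

Let mcv u : measurable_fun setT (cond_version u).
Proof. by have := gen_measurableT mz (@gen_measurable_cond_version u). Qed.

Lemma cond_sum_fin u :
  {ae P, forall w, (cond_version u w)%:E = cond_sum u (S u w)}.
Proof.
have mc : measurable_fun setT (fun w => cond_sum u (S u w)).
  exact: (measurableT_comp (@measurable_cond_sum u)).
have : P.-integrable setT (fun w => cond_sum u (S u w)).
  apply/integrableP; split => //.
  under eq_integral => w _ do rewrite gee0_abs ?cond_sum_ge0// -[cond_sum _ _]mule1.
  (* Projecting from the full index set against the constant 1 identifies the total integral with
     the mean of [fz], which is finite. *)
  rewrite -(finset.setTI u) -(@cond_sum_project finset.setT u (cst 1)) => [||//]; last exact: measurable_cst.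
  under eq_integral => w _ do rewrite mule1 cond_sumT.
  by rewrite (Ex_fin (sqint_intg sF)) ltry.
move=> /(integrable_ae measurableT); apply: filterS => w /(_ I).
by rewrite /cond_version => /fineK.
Qed.

(** Jensen on a single section, as nonnegativity of a variance. Sections with infinite second moment
    need no argument, so no integrability in [t] is asked for. *)
Lemma cond_sum_jensen u t :
  (((fine (cond_sum u t)) ^+ 2)%:E <= \int[P]_w ((H (t + S (~: u) w)) ^+ 2)%:E)%E.
Proof.
set X := fun w => H (t + S (~: u) w).
have mX : measurable_fun setT X.
  by apply: (measurableT_comp mH); apply: measurable_funD.
have [iX|] := ltP (\int[P]_w ((X w) ^+ 2)%:E)%E +oo%E; last first.
  by rewrite leye_eq => /eqP ->; rewrite leey.
have sX : sqint P X.
  split => //; apply: intg_lty => //; first exact: measurable_funX.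
  by move=> w; exact: sqr_ge0.
rewrite -[fine _]/(Ex P X) (Ex_fin sX.2) lee_fin -subr_ge0.
have := Ex_sqr_ge0 P (fun w => X w - Ex P X).
have -> : (fun w => (X w - Ex P X) ^+ 2) =
    (fun w => X w ^+ 2 - (2 * Ex P X) * X w + Ex P X ^+ 2).
  by apply/funext => w; ring.
have iXX := sqint_intg sX; have iX2 := sX.2.
rewrite ExD; [|by apply: intgB => //; exact: intgZ|exact: intg_cst].
rewrite ExB//; last exact: intgZ.
by rewrite ExZ// Ex_cst (_ : _ + _ = Ex P (fun w => X w ^+ 2) - Ex P X ^+ 2)//; ring.
Qed.

Lemma sqint_cond_version u : sqint P (cond_version u).
Proof.
split => //; apply: intg_lty; first exact: measurable_funX.
  by move=> w; exact: sqr_ge0.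
have dis : [disjoint u & ~: u]%B by rewrite finset.disjoints_subset finset.setCK.
have mk : measurable_fun setT (fun y : R * R => ((H (y.1 + y.2)) ^+ 2)%:E).
  apply/measurable_EFinP; apply: measurable_funX; apply: (measurableT_comp mH).
  exact: measurable_funD.
apply: (@le_lt_trans _ _ (\int[P]_w ((fz w) ^+ 2)%:E)%E); last first.
  by rewrite (Ex_fin sF.2) ltry.
have -> : (\int[P]_w ((fz w) ^+ 2)%:E = \int[P]_w ((H (S u w + S (~: u) w)) ^+ 2)%:E)%E.
  apply: eq_integral => w _; rewrite -SU// finset.setUCr /fz fE.
  by congr (H _ ^+ 2)%:E; apply: eq_bigl => j; rewrite inE.
have k0 y : (0 <= (fun y : R * R => ((H (y.1 + y.2)) ^+ 2)%:E) y)%E.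
  by rewrite lee_fin sqr_ge0.
have /= -> := @indep_decouple _ _ _ P d z mz zI _ _ _ _ _ _ (S u) (S (~: u))
  (fun y : R * R => ((H (y.1 + y.2)) ^+ 2)%:E) dis (@mS _) (@mS _) mk k0.
apply: ge0_le_integral => //.
- by move=> w _; rewrite lee_fin sqr_ge0.
- by apply/measurable_EFinP; exact: measurable_funX.
- pose g := fun y : R * T => ((H (y.1 + S (~: u) y.2)) ^+ 2)%:E.
  have mg : measurable_fun setT g.
    apply/measurable_EFinP; apply: measurable_funX; apply/measurable_EFinP; exact: (@m_sum u).
  have mG : measurable_fun setT (fun t : R => \int[P]_w g (t, w))%E.
    by apply: (@measurable_fun_fubini_tonelli_F _ _ _ _ _ P _ mg) => y; rewrite lee_fin sqr_ge0.
  exact: (measurableT_comp mG (mST u)).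
- by move=> w _; exact: cond_sum_jensen.
Qed.

Lemma cond_version_project u v (q : T -> R) : gen_measurable z v q -> sqint P q ->
  Ex P (fun w => cond_version u w * q w) = Ex P (fun w => cond_version (u :&: v) w * q w).
Proof.
have pos (q' : T -> R) : gen_measurable z v q' -> (forall w, 0 <= q' w) ->
  Ex P (fun w => cond_version u w * q' w) = Ex P (fun w => cond_version (u :&: v) w * q' w).
  move=> vq q0.
  have mq := gen_measurableT mz vq.
  have E x : (\int[P]_w (cond_version x w * q' w)%:E =
              \int[P]_w (cond_sum x (S x w) * (q' w)%:E))%E.
    apply: ae_eq_integral => //.
    - by apply/measurable_EFinP; exact: measurable_funM.
    - apply: emeasurable_funM; last exact/measurable_EFinP.
      exact: (measurableT_comp (@measurable_cond_sum _)).
    - by apply: filterS (cond_sum_fin x) => w /= <- _; rewrite EFinM.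
  exact: (f_equal fine (etrans (E u) (etrans (cond_sum_project u vq q0) (esym (E (u :&: v)))))).
move=> vq sq.
have s1 : sqint P (fun w => Num.max (q w) 0).
  apply: (sqint_dom _ sq.2); first by apply: measurable_maxr => //; case: sq.
  apply: aeW => w; case: (lerP 0 (q w)) => // _.
  by rewrite expr0n /= sqr_ge0.
have s2 : sqint P (fun w => Num.max (- q w) 0).
  apply: (sqint_dom _ sq.2).
    by apply: measurable_maxr => //; apply: measurableT_comp => //; case: sq.
  apply: aeW => w; case: (lerP 0 (- q w)) => // _; rewrite ?sqrrN//.
  by rewrite expr0n /= sqr_ge0.
have split_ x : Ex P (fun w => cond_version x w * q w) =
    Ex P (fun w => cond_version x w * Num.max (q w) 0) -
    Ex P (fun w => cond_version x w * Num.max (- q w) 0).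
  rewrite -ExB; [|by apply: intgM => //; exact: sqint_cond_version..].
  congr Ex; apply/funext => w; rewrite -mulrBr; congr (_ * _).
  by case: (lerP 0 (q w)) => h; case: (lerP 0 (- q w)) => h'; lra.
have e1 := pos (fun w => Num.max (q w) 0) (measurable_maxr vq (measurable_cst _))
  (fun w => ltac:(by rewrite le_max lexx orbT)).
have e2 := pos (fun w => Num.max (- q w) 0)
  (measurable_maxr (measurableT_comp (@oppr_measurable R setT) vq) (measurable_cst _))
  (fun w => ltac:(by rewrite le_max lexx orbT)).
exact: (etrans (split_ u) (etrans (f_equal2 (fun a b => a - b) e1 e2) (esym (split_ (u :&: v))))).
Qed.

Let integral_restr (A : set T) (X : T -> R) :
  (\int[P]_(w in A) (X w)%:E = \int[P]_w (X w * \1_A w)%:E)%E.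
Proof.
rewrite integral_mkcond; apply: eq_integral => w _.
by rewrite patchE indicE; case: ifPn => _; rewrite ?mulr1 ?mulr0.
Qed.

Let gen_indic u A : sigma_of z u A -> gen_measurable z u (\1_A : T -> R).
Proof. by move=> uA; apply: (@measurable_indic _ (gen_type z u)). Qed.

Let sq_indic u A : sigma_of z u A -> sqint P (\1_A : T -> R).
Proof.
move=> /gen_indic/(gen_measurableT mz) m1; apply: (sqint_dom m1 (intg_cst P 1)).
by apply: aeW => w; rewrite indicE; case: (_ \in _); rewrite ?expr1n ?expr0n.
Qed.

Lemma cond_versionT w : cond_version [set: 'I_d] w = fz w.
Proof. by rewrite /cond_version cond_sumT. Qed.

Lemma is_condexp_cond_version u : is_condexp P (sigma_of z u) fz (cond_version u).
Proof.
split.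
- move=> _ [B mB <-]; rewrite setTI.
  by move/gen_measurableP: (@gen_measurable_cond_version u); exact.
- exact: sqint_intg (sqint_cond_version u).
- move=> A uA; have s1 := sq_indic uA.
  have i1 : intg P (fun w => cond_version u w * \1_A w).
    by apply: intgM => //; exact: sqint_cond_version.
  have i2 : intg P (fun w => fz w * \1_A w) by exact: intgM.
  have e : Ex P (fun w => fz w * \1_A w) = Ex P (fun w => cond_version u w * \1_A w).
    (* The version for the full index set is [fz] itself, so the defining property is the projection
       identity tested against an indicator. *)
    have e' := cond_version_project finset.setT (gen_indic uA) s1.
    rewrite finset.setTI in e'; rewrite -e'.
    by congr (Ex P _); apply/funext => w; rewrite cond_versionT.
  exact: (etrans (integral_restr A (cond_version u)) (etrans (Ex_fin i1)
    (etrans (f_equal EFin (esym e)) (esym (etrans (integral_restr A fz) (Ex_fin i2)))))).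
Qed.

Let C u := condexp P (sigma_of z u) fz.

Let CP u : is_condexp P (sigma_of z u) fz (C u).
Proof. by apply: (xgetPex (cst 0)); exists (cond_version u); exact: is_condexp_cond_version. Qed.

Let mC u : gen_measurable z u (C u).
Proof.
case: (CP u) => h _ _; apply/gen_measurableP => B mB; apply: h.
by exists B => //; rewrite setTI.
Qed.

(** Of the chosen version only [is_condexp] is known. The difference of the two versions integrates
    to 0 over the sets where it is positive and where it is negative, both in [sigma_of z u], so its
    absolute value has integral 0. *)
Lemma condexp_ae u : {ae P, forall w, C u w = cond_version u w}.
Proof.
have [_ iC EC] := CP u.
have [_ iV EV] := is_condexp_cond_version u.
pose D w := C u w - cond_version u w.
have iD : intg P D by exact: intgB.
have gD : gen_measurable z u D.
  apply: (@measurable_funB _ (gen_type z u) R setT (C u) (cond_version u)).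
    exact: mC.
  exact: gen_measurable_cond_version.
have mD := gen_measurableT mz gD.
have i0 A : sigma_of z u A -> intg P (fun w => D w * \1_A w) /\ Ex P (fun w => D w * \1_A w) = 0.
  move=> uA; have m1 := gen_measurableT mz (gen_indic uA).
  have i1 X : intg P X -> intg P (fun w => X w * \1_A w).
    move=> iX; apply: (intg_dom _ (integrable_norm iX)).
      by apply: measurable_funM => //; exact: intg_measurable iX.
    by apply: aeW => w /=; rewrite normrM indicE; case: (_ \in _); rewrite ?normr1 ?normr0 ?mulr1 ?mulr0.
  split; first exact: i1.
  have -> : (fun w => D w * \1_A w) = fun w => C u w * \1_A w - cond_version u w * \1_A w.
    by apply/funext => w; rewrite mulrBl.
  rewrite ExB; [|exact: i1..]; apply/eqP; rewrite subr_eq0; apply/eqP; apply: EFin_inj.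
  by rewrite -!Ex_fin; [|exact: i1..]; rewrite -!integral_restr EC// EV.
have uA : sigma_of z u (D @^-1` `]0, +oo[%classic).
  by move/gen_measurableP: gD; apply; exact: measurable_itv.
have uB : sigma_of z u (D @^-1` `]-oo, 0[%classic).
  by move/gen_measurableP: gD; apply; exact: measurable_itv.
have [iA EA] := i0 _ uA; have [iB EB] := i0 _ uB.
have : (\int[P]_w `|(D w)%:E| = 0)%E.
  transitivity (\int[P]_w ((D w * \1_(D @^-1` `]0%R, +oo[%classic) w -
     D w * \1_(D @^-1` `]-oo, 0%R[%classic) w)%R%:E))%E.
    apply: eq_integral => w _; rewrite abse_EFin !indicE; congr EFin.
    have -> : (w \in D @^-1` `]0, +oo[%classic) = (0 < D w).
      by apply/idP/idP; rewrite inE /= in_itv/= andbT.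
    have -> : (w \in D @^-1` `]-oo, 0[%classic) = (D w < 0).
      by apply/idP/idP; rewrite inE /= in_itv.
    case: (ltrgtP (D w) 0) => h; rewrite ?mulr1 ?mulr0 ?subr0 ?sub0r.
    - by rewrite ltr0_norm.
    - by rewrite gtr0_norm.
    - by rewrite h normr0.
  by rewrite Ex_fin ?ExB ?EA ?EB ?subrr//; exact: intgB.
have mDE : measurable_fun setT (EFin \o D) by exact/measurable_EFinP.
move=> h0; have := (ae_eq_integral_abs P measurableT mDE).1 h0.
by apply: filterS => w /(_ I) /= [] /eqP; rewrite subr_eq0 => /eqP.
Qed.

Let mCT u : measurable_fun setT (C u).
Proof. exact: (gen_measurableT mz (@mC u)). Qed.

Lemma sqint_condexp u : sqint P (C u).
Proof.
have [mV iV] := sqint_cond_version u.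
split => //; apply: (intg_ae _ iV); first exact: measurable_funX.
by apply: filterS (condexp_ae u) => w ->.
Qed.

Lemma condexp_project u v (q : T -> R) : gen_measurable z v q -> sqint P q ->
  Ex P (fun w => C u w * q w) = Ex P (fun w => C (u :&: v) w * q w).
Proof.
move=> vq sq; have mq : measurable_fun setT q by case: sq.
have E x : Ex P (fun w => C x w * q w) = Ex P (fun w => cond_version x w * q w).
  apply: Ex_ae; [exact: measurable_funM..|].
  by apply: filterS (condexp_ae x) => w ->.
exact: (etrans (E u) (etrans (cond_version_project u vq sq) (esym (E (u :&: v))))).
Qed.

(** * Orthogonality and variances of the ANOVA components *)

Let g u := anova P z f u.

Let gE u w : g u w = C u w - \sum_(v : {set 'I_d} | v \proper u) g v w.
Proof. exact: anovaE. Qed.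

Lemma gen_measurable_anova u : gen_measurable z u (g u).
Proof.
have [n] := ubnP #|u|; elim: n u => // n IH u; rewrite ltnS => un.
rewrite /gen_measurable.
have -> : g u = fun w => C u w - \sum_(v : {set 'I_d}) (if v \proper u then g v w else 0).
  by apply/funext => w; rewrite gE big_mkcond.
apply: measurable_funB; first exact: mC.
apply: (@measurable_sum _ (gen_type z u) R setT _ _
  (fun v w => if v \proper u then g v w else 0)) => v.
case vu: (v \proper u); last exact: measurable_cst.
apply: (@gen_measurableS _ _ _ _ _ _ _ v u); first exact: proper_sub.
by apply: IH; exact: leq_trans (proper_card vu) un.
Qed.

Lemma sqint_anova u : sqint P (g u).
Proof.
have [n] := ubnP #|u|; elim: n u => // n IH u; rewrite ltnS => un.
have -> : g u = fun w => C u w - \sum_(v : {set 'I_d} | v \proper u) g v w.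
  by apply/funext => w; rewrite gE.
apply: sqintB; first exact: sqint_condexp.
by apply: sqint_sum => v vu; apply: IH; exact: leq_trans (proper_card vu) un.
Qed.

Lemma condexp_anova u w : C u w = \sum_(v : {set 'I_d} | v \subset u) g v w.
Proof.
rewrite (bigD1 u)//= gE addrAC -addrA.
have -> : \sum_(v : {set 'I_d} | v \proper u) g v w =
          \sum_(v : {set 'I_d} | (v \subset u) && (v != u)) g v w.
  by apply: eq_bigl => v; rewrite finset.properEneq andbC.
by rewrite subrr addr0.
Qed.

(** Induction on the size of [u]. Against [q] the conditional expectation on [u] acts like the one
    on [u :&: v], which is the sum of the components below [u :&: v]. Among the components
    subtracted in [anovaE], those not inside [v] vanish by induction, and the others are exactly
    these, since a subset of [u :&: v] cannot be all of [u]. *)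
Lemma anova_orth u v (q : T -> R) : ~~ (u \subset v) -> gen_measurable z v q -> sqint P q ->
  Ex P (fun w => g u w * q w) = 0.
Proof.
move=> + vq sq; have [n] := ubnP #|u|; elim: n u => // n IH u; rewrite ltnS => un uv.
have iC x : intg P (fun w => C x w * q w) by apply: intgM => //; exact: sqint_condexp.
have ig x : intg P (fun w => g x w * q w) by apply: intgM => //; exact: sqint_anova.
have -> : (fun w => g u w * q w) = fun w => C u w * q w -
    \sum_(x : {set 'I_d} | x \proper u) g x w * q w.
  by apply/funext => w; rewrite gE mulrBl mulr_suml.
rewrite ExB//; last exact: intg_sum.
rewrite Ex_sum// (condexp_project _ vq sq).
have -> : (fun w => C (u :&: v) w * q w) =
    fun w => \sum_(x : {set 'I_d} | x \subset u :&: v) g x w * q w.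
  by apply/funext => w; rewrite condexp_anova mulr_suml.
rewrite Ex_sum// (bigID (fun x : {set 'I_d} => x \subset v) (fun x => x \proper u))/=.
rewrite [X in _ - (_ + X)]big1 ?addr0; last first.
  by move=> x /andP[xu xv]; apply: IH => //; exact: leq_trans (proper_card xu) un.
apply/eqP; rewrite subr_eq0; apply/eqP; apply: eq_bigl => x; rewrite finset.subsetI.
apply/andP/andP => -[xu xv]; split => //; last exact: proper_sub.
rewrite finset.properEneq xu andbT; apply: contraNneq uv => <- //.
Qed.

Lemma anova_orth2 u v : u != v -> Ex P (fun w => g u w * g v w) = 0.
Proof.
move=> uv; have [uv1|uv1] := boolP (u \subset v).
  under eq_fun do rewrite mulrC.
  apply: (@anova_orth v u); [|exact: gen_measurable_anova|exact: sqint_anova].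
  by apply: contra uv => vu; rewrite finset.eqEsubset uv1.
by apply: anova_orth uv1 _ _; [exact: gen_measurable_anova|exact: sqint_anova].
Qed.

Let a u := Ex P (fun w => g u w ^+ 2).

Let igg u v : intg P (fun w => g u w * g v w).
Proof. by apply: intgM; exact: sqint_anova. Qed.

Lemma anova_sum_mul (J : pred {set 'I_d}) v : J v ->
  Ex P (fun w => (\sum_(u | J u) g u w) * g v w) = a v.
Proof.
move=> Jv; under eq_fun do rewrite mulr_suml.
rewrite Ex_sum; last by move=> u _; exact: igg.
rewrite (bigD1 v)//= big1 ?addr0; first by congr Ex.
by move=> u /andP[_]; exact: anova_orth2.
Qed.

Lemma anova_sum_sqr (J : pred {set 'I_d}) :
  Ex P (fun w => (\sum_(u | J u) g u w) ^+ 2) = \sum_(u | J u) a u.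
Proof.
have -> : (fun w => (\sum_(u | J u) g u w) ^+ 2) =
    fun w => \sum_(v | J v) (\sum_(u | J u) g u w) * g v w.
  by apply/funext => w; rewrite expr2 mulr_sumr.
rewrite Ex_sum => [|v Jv]; first by apply: eq_bigr => v Jv; exact: anova_sum_mul.
apply: intgM; last exact: sqint_anova.
by apply: sqint_sum => u _; exact: sqint_anova.
Qed.

Lemma condexpT_ae : {ae P, forall w, fz w = \sum_u g u w}.
Proof.
apply: filterS (condexp_ae finset.setT) => w; rewrite cond_versionT => <-.
by rewrite condexp_anova; apply: eq_bigl => u; rewrite finset.subsetT.
Qed.

Let m_sum_anova (J : pred {set 'I_d}) : measurable_fun setT (fun w => \sum_(u | J u) g u w).
Proof. by have [] : sqint P (fun w => \sum_(u | J u) g u w) by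
  apply: sqint_sum => u _; exact: sqint_anova. Qed.

Lemma Ex_anova u : u != finset.set0 -> Ex P (g u) = 0.
Proof.
move=> u0; have := @anova_orth u finset.set0 (fun=> 1); rewrite finset.subset0.
move=> /(_ u0 (measurable_cst _) (sqint_cst P 1)).
by under eq_fun do rewrite mulr1.
Qed.

Lemma variance_anova u : u != finset.set0 -> fine 'V_P[anova P z f u] = a u.
Proof.
move=> u0; rewrite (variance_Ex (sqint_anova u)) /= [Ex P (g u)]Ex_anova//.
by rewrite expr0n subr0.
Qed.

Lemma variance_anova_sum :
  fine 'V_P[fz] = \sum_(u : {set 'I_d} | u != finset.set0) a u.
Proof.
have mF : measurable_fun setT fz by case: sF.
have mG := @m_sum_anova xpredT.
rewrite (variance_Ex sF) /=.
have -> : Ex P (fun w => fz w ^+ 2) = \sum_u a u.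
  rewrite -anova_sum_sqr; apply: Ex_ae; [exact: measurable_funX..|].
  by apply: filterS condexpT_ae => w ->.
have -> : Ex P fz = Ex P (g finset.set0).
  rewrite (Ex_ae mF mG condexpT_ae) Ex_sum => [|u _]; last exact/sqint_intg/sqint_anova.
  by rewrite (bigD1 finset.set0)//= big1 ?addr0// => u u0; exact: Ex_anova.
rewrite (bigD1 finset.set0)//= addrC.
suff -> : a finset.set0 = Ex P (g finset.set0) ^+ 2 by rewrite addrK.
have i0 := sqint_intg (sqint_anova finset.set0).
have g0 := @gen_measurable_anova finset.set0.
(* The empty index set is disjoint from itself, so the component at [set0] is independent of itself
   and its second moment is its squared mean. *)
have dis : [disjoint (finset.set0 : {set 'I_d}) & (finset.set0 : {set 'I_d})]%B.
  by rewrite finset.disjoints_subset finset.sub0set.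
have [_ E] := indep_intg_prod mz zI dis g0 g0 i0 i0.
by rewrite expr2 -E.
Qed.

(** A function free of [z i] is orthogonal to every component involving [i], and likewise for [j].
    Subtracting [q1] and [q2] therefore keeps the inner product with the sum [G] of the components
    involving both, and nonnegativity of the mean square of [D - G] concludes. *)
Lemma anova_pair_bound (i j : 'I_d) (q1 q2 : T -> R) :
  gen_measurable z (~: [set i]%SET) q1 -> sqint P q1 ->
  gen_measurable z (~: [set j]%SET) q2 -> sqint P q2 ->
  \sum_(u : {set 'I_d} | (i \in u) && (j \in u)) a u
    <= Ex P (fun w => (fz w - q1 w - q2 w) ^+ 2).
Proof.
move=> g1 s1 g2 s2.
pose J (u : {set 'I_d}) := (i \in u) && (j \in u).
pose G w := \sum_(u | J u) g u w.
pose D w := \sum_u g u w - q1 w - q2 w.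
have mF : measurable_fun setT fz by case: sF.
have sG : sqint P G by apply: sqint_sum => u _; exact: sqint_anova.
have sA : sqint P (fun w => \sum_u g u w) by apply: sqint_sum => u _; exact: sqint_anova.
have sD : sqint P D by apply: sqintB => //; exact: sqintB.
have -> : Ex P (fun w => (fz w - q1 w - q2 w) ^+ 2) = Ex P (fun w => D w ^+ 2).
  apply: Ex_ae.
  - by case: s1 s2 => ? _ [? _]; apply: measurable_funX; do 2 apply: measurable_funB => //.
  - by apply: measurable_funX; case: sD.
  - by apply: filterS condexpT_ae => w ->.
have EDG : Ex P (fun w => D w * G w) = \sum_(u | J u) a u.
  under eq_fun do rewrite mulr_sumr.
  rewrite Ex_sum => [|u _]; last by apply: intgM => //; exact: sqint_anova.
  apply: eq_bigr => u /andP[iu ju].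
  have -> : (fun w => D w * g u w) = fun w =>
      (\sum_u g u w) * g u w - g u w * q1 w - g u w * q2 w.
    by apply/funext => w; rewrite /D; ring.
  have su := sqint_anova u.
  rewrite ExB ?ExB; [|exact: intgM|exact: intgM|by apply: intgB; exact: intgM|exact: intgM].
  rewrite anova_sum_mul// (anova_orth _ g1 s1) ?(anova_orth _ g2 s2) ?subr0//.
  - by apply/negP => /fintype.subsetP/(_ _ ju); rewrite !inE eqxx.
  - by apply/negP => /fintype.subsetP/(_ _ iu); rewrite !inE eqxx.
have := Ex_sqr_ge0 P (fun w => D w - G w).
have -> : (fun w => (D w - G w) ^+ 2) = fun w => D w ^+ 2 - 2 * (D w * G w) + G w ^+ 2.
  by apply/funext => w; ring.
have iDG : intg P (fun w => D w * G w) by exact: intgM.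
have [_ iD] := sD; have [_ iG] := sG.
rewrite ExD//; last by apply: intgB => //; exact: intgZ.
rewrite ExB//; last exact: intgZ.
rewrite ExZ//.
by rewrite EDG anova_sum_sqr; rewrite /J; lra.
Qed.

Lemma anova_sqr_ge0 u : 0 <= a u.
Proof. exact: Ex_sqr_ge0. Qed.

(* Since |u| - 1 <= |u| (|u| - 1) / 2, the excess of the mean dimension over 1 is
   controlled by the components that involve a given pair of variables. *)
Lemma mean_dim_pair_bound (B : R) : 0 < fine 'V_P[fz] ->
  (\sum_(i < d) \sum_(j < d | j != i)
     \sum_(u : {set 'I_d} | (i \in u) && (j \in u)) a u <= B) ->
  mean_dim P z f <= 1 + B / 2 / fine 'V_P[fz].
Proof.
move=> V0 hB; rewrite /mean_dim -/fz ler_pdivrMr// mulrDl mul1r divfK ?gt_eqF//.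
apply: (@le_trans _ _ (fine 'V_P[fz] + (\sum_(i < d) \sum_(j < d | j != i)
     \sum_(u : {set 'I_d} | (i \in u) && (j \in u)) a u) / 2)); last first.
  by rewrite lerD2l ler_pM2r.
(* Exchanging sums counts each [u] once per ordered pair of distinct elements. The truncated
   predecessor is harmless at the empty set because of the other factor. *)
have -> : \sum_(i < d) \sum_(j < d | j != i)
     \sum_(u : {set 'I_d} | (i \in u) && (j \in u)) a u =
   \sum_(u : {set 'I_d}) (#|u| * #|u|.-1)%:R * a u.
  under eq_bigr => i _ do under eq_bigr => j _ do rewrite big_mkcond.
  under eq_bigr => i _ do rewrite exchange_big.
  rewrite exchange_big; apply: eq_bigr => u _ /=.
  rewrite (eq_bigr (fun i => if i \in u then #|u|.-1%:R * a u else 0)).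
    by rewrite -big_mkcond /= sumr_const natrM -mulrA !mulr_natl.
  move=> i _; case: ifPn => iu; last by rewrite big1.
  rewrite -big_mkcondr /= (eq_bigl (mem (u :\ i))); last by move=> j; rewrite !inE.
  by rewrite sumr_const (cardsD1 i u) iu mulr_natl.
rewrite variance_anova_sum mulr_suml.
rewrite (bigD1 finset.set0)//= cards0 mul0r add0r.
rewrite [X in _ <= _ + X](bigD1 finset.set0)//= cards0 !mul0r add0r -big_split /=.
apply: ler_sum => u u0; rewrite variance_anova//.
have : (0 < #|u|)%N by rewrite card_gt0.
have := anova_sqr_ge0 u; move: (a u) => x x0.
case: #|u| => // n _ /=; rewrite natrM.
have [|n1] := leqP n 0; first by rewrite leqn0 => /eqP ->; lra.
have : (1 : R) <= n%:R by rewrite ler1n.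
rewrite -natr1; move: (n%:R) => m m1.
have := mulr_ge0 (mulr_ge0 (le_trans ler01 m1) x0) (eqbRL (subr_ge0 1 m) m1); lra.
Qed.

End anova_of_sum.

(** * Moments of sums *)

Lemma set_add_ind (I : finType) (Q : {set I} -> Prop) : Q finset.set0 ->
  (forall j (J : {set I}), j \notin J -> Q J -> Q (j |: J)%SET) -> forall J, Q J.
Proof.
move=> Q0 QS J; have [n] := ubnP #|J|; elim: n J => // n IH J; rewrite ltnS => Jn.
have [->//|[j jJ]] := finset.set_0Vmem J.
rewrite -(finset.setD1K jJ); apply: QS; first by rewrite !inE eqxx.
by apply: IH; move: Jn; rewrite (cardsD1 j J) jJ.
Qed.

Lemma ler_add_weighted (R : realType) (a b c y1 y2 K : R) :
  a * y2 <= a * K -> b * y1 <= b * K -> c * y2 <= c * K ->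
  a + (b + (c + (a * y2 + (b * y1 + c * y2)))) <= (a + b + c) * (1 + K).
Proof. by lra. Qed.

(** Here [s1] and [s2] are the sums over the two halves, [D1] and [D2] their centered versions, and
    [c] the part of [mu] carried by the coordinates left out. The factor 3 comes from squaring a sum
    of three terms. Each centered square is paired with the power of the opposite half, which is
    independent of it; the constant [c] may go with either. *)
Lemma powR_neg_split (R : realType) (q mu s1 s2 D1 D2 c Y1 Y2 : R) :
  0 < q -> 0 < mu -> 0 < s1 -> 0 < s2 -> s1 + s2 = D1 + D2 - c + mu ->
  Y1 = (s1 / mu) `^ (- q - 2) -> Y2 = (s2 / mu) `^ (- q - 2) ->
  ((s1 + s2) / mu) `^ (- q) <= 1 + ((- q / mu) * (D1 + D2 - c) +
    q * (q + 1) * (3 / mu ^+ 2) * (D1 ^+ 2 + (D2 ^+ 2 + (c ^+ 2 +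
      (D1 ^+ 2 * Y2 + (D2 ^+ 2 * Y1 + c ^+ 2 * Y2)))))).
Proof.
move=> q0 mu0 s10 s20 sE Y1E Y2E.
have y0 : 0 < (s1 + s2) / mu by rewrite divr_gt0// addr_gt0.
apply: (le_trans (powR_taylor_neg q0 y0)).
set t := _ `^ (- q - 2).
have t0 : 0 <= t by exact: powR_ge0.
have h1 : t <= Y1.
  rewrite Y1E; apply: ler_powR_neg; [lra|exact: divr_gt0|].
  by rewrite ler_pM2r ?invr_gt0//; lra.
have h2 : t <= Y2.
  rewrite Y2E; apply: ler_powR_neg; [lra|exact: divr_gt0|].
  by rewrite ler_pM2r ?invr_gt0//; lra.
have -> : (s1 + s2) / mu - 1 = (D1 + D2 - c) / mu.
  by rewrite sE; field; exact: lt0r_neq0.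
have -> : 1 - q * ((D1 + D2 - c) / mu) + q * (q + 1) *
    (((D1 + D2 - c) / mu) ^+ 2 * (1 + t)) =
  1 + (- q / mu * (D1 + D2 - c) + q * (q + 1) / mu ^+ 2 * ((D1 + D2 - c) ^+ 2 * (1 + t))).
  by field; exact: lt0r_neq0.
rewrite lerD2l lerD2l.
set B := (X in _ <= _ * X).
have -> : q * (q + 1) * (3 / mu ^+ 2) * B = q * (q + 1) / mu ^+ 2 * (3 * B).
  by field; exact: lt0r_neq0.
apply: ler_wpM2l.
  by rewrite divr_ge0 ?sqr_ge0// mulr_ge0//; lra.
have e1 : (D1 + D2 - c) ^+ 2 <= 3 * (D1 ^+ 2 + D2 ^+ 2 + c ^+ 2).
  have := sqr_ge0 (D1 - D2); have := sqr_ge0 (D1 + c); have := sqr_ge0 (D2 + c).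
  by move=> *; lra.
have t1 : 0 <= 1 + t by lra.
apply: (le_trans (ler_wpM2r t1 e1)).
have k1 := ler_wpM2l (sqr_ge0 D1) h2.
have k2 := ler_wpM2l (sqr_ge0 D2) h1.
have k3 := ler_wpM2l (sqr_ge0 c) h2.
by rewrite /B; lra.
Qed.

Lemma ler_variance_lower (R : realType) (s k c a b p : R) :
  s + (p - 1) / 2 * k <= c -> 0 <= a - 2 * c + s - b -> s + (p - 1) * k <= a - b.
Proof. by lra. Qed.

Section moments.
Context {dT : measure_display} {T : measurableType dT} {R : realType}.
Variable P : probability T R.
Variables (d : nat) (z : 'I_d -> T -> R).
Hypothesis mz : forall j, measurable_fun setT (z j).
Hypothesis zI : forall (J : {set 'I_d}) (B : 'I_d -> set R),
  (forall j, measurable (B j)) ->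
  (P (\bigcap_(j in [set` J]) z j @^-1` B j) = \prod_(j in J) P (z j @^-1` B j))%E.
Implicit Types (J u v : {set 'I_d}).

Lemma gen_measurable_single (j : 'I_d) : gen_measurable z [set j]%SET (z j).
Proof. by apply: gen_measurable_coord; rewrite inE. Qed.

Lemma disjoint_add (j : 'I_d) J : j \notin J -> [disjoint [set j]%SET & J]%B.
Proof. by move=> jJ; rewrite finset.disjoints_subset finset.sub1set inE. Qed.

Lemma gen_measurable_powR_comp u (X : T -> R) r : gen_measurable z u X ->
  gen_measurable z u (fun w => X w `^ r).
Proof. exact: (measurableT_comp (measurable_powR r)). Qed.

Lemma indep_prod J (F : 'I_d -> T -> R) :
  (forall j, gen_measurable z [set j]%SET (F j)) -> (forall j, intg P (F j)) ->
  [/\ gen_measurable z J (fun w => \prod_(j in J) F j w),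
      intg P (fun w => \prod_(j in J) F j w) &
      Ex P (fun w => \prod_(j in J) F j w) = \prod_(j in J) Ex P (F j)].
Proof.
move=> mF iF; elim/set_add_ind: J => [|j J jJ [mJ iJ EJ]].
  rewrite big_set0 (_ : (fun w => _) = fun=> 1).
    by rewrite Ex_cst; split => //; [exact: measurable_cst|exact: intg_cst].
  by apply/funext => w; rewrite big_set0.
have E : (fun w => \prod_(i in (j |: J)%SET) F i w) =
    (fun w => F j w * \prod_(i in J) F i w).
  by apply/funext => w; rewrite big_setU1.
have [iP EP] := indep_intg_prod mz zI (disjoint_add jJ) (mF j) mJ (iF j) iJ.
rewrite E big_setU1// -EJ; split => //.
apply: (@measurable_funM _ (gen_type z (j |: J)%SET) R setT (F j)).
  by apply: (gen_measurableS _ (mF j)); rewrite finset.sub1set !inE eqxx.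
by apply: (gen_measurableS _ mJ); exact: finset.subsetUr.
Qed.

(** In the square and the cube of a sum of two independent centered terms, every mixed product has
    one factor to the first power, hence mean 0. Variance and third central moment are thus
    additive. *)
Lemma centered_sum_moments J (X : 'I_d -> T -> R) :
  (forall j, gen_measurable z [set j]%SET (X j)) -> (forall j, sqint P (X j)) ->
  (forall j, intg P (fun w => X j w ^+ 3)) -> (forall j, Ex P (X j) = 0) ->
  let S w := \sum_(j in J) X j w in
  [/\ gen_measurable z J S, sqint P S /\ Ex P S = 0,
      Ex P (fun w => S w ^+ 2) = \sum_(j in J) Ex P (fun w => X j w ^+ 2),
      intg P (fun w => S w ^+ 3) &
      Ex P (fun w => S w ^+ 3) = \sum_(j in J) Ex P (fun w => X j w ^+ 3)].
Proof.
move=> mX sX iX3 X0 /=; elim/set_add_ind: J => [|j J jJ].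
  have E : (fun w => \sum_(j in finset.set0) X j w) = fun=> 0.
    by apply/funext => w; rewrite big_set0.
  have E' k : (fun w => (\sum_(j in finset.set0) X j w) ^+ k.+1) = fun=> 0.
    by apply/funext => w; rewrite big_set0 expr0n.
  rewrite E !E' !big_set0 !Ex_cst; split => //.
  - exact: measurable_cst.
  - by split => //; exact: sqint_cst.
  - exact: intg_cst.
set s := fun w => \sum_(i in J) X i w.
move=> [ms [ss s0] s2 is3 s3].
have E w : \sum_(i in (j |: J)%SET) X i w = X j w + s w by rewrite big_setU1.
rewrite (_ : (fun w => \sum_(i in (j |: J)%SET) X i w) = fun w => X j w + s w); last first.
  by apply/funext.
have dis := disjoint_add jJ.
have ix := sqint_intg (sX j); have is1 := sqint_intg ss.
have [mXj ix2] := sX j; have [mS is2] := ss.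
have mX2 : gen_measurable z [set j]%SET (fun w => X j w ^+ 2).
  exact: (@measurable_funX _ (gen_type z [set j]%SET) R setT (X j) 2 (mX j)).
have ms2 : gen_measurable z J (fun w => s w ^+ 2).
  exact: (@measurable_funX _ (gen_type z J) R setT s 2 ms).
have [i11 E11] := indep_intg_prod mz zI dis (mX j) ms ix is1.
have [i21 E21] := indep_intg_prod mz zI dis mX2 ms ix2 is1.
have [i12 E12] := indep_intg_prod mz zI dis (mX j) ms2 ix is2.
have e2 : (fun w => (\sum_(i in (j |: J)%SET) X i w) ^+ 2) =
    fun w => X j w ^+ 2 + (2 * (X j w * s w) + s w ^+ 2).
  by apply/funext => w; rewrite E; ring.
have e3 : (fun w => (\sum_(i in (j |: J)%SET) X i w) ^+ 3) = fun w => X j w ^+ 3 +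
    (3 * (X j w ^+ 2 * s w) + (3 * (X j w * s w ^+ 2) + s w ^+ 3)).
  by apply/funext => w; rewrite E; ring.
have j11 := intgZ 2 i11; have j21 := intgZ 3 i21; have j12 := intgZ 3 i12.
have k2 := intgD j11 is2; have k3 := intgD j12 is3; have k3' := intgD j21 k3.
rewrite e2 e3 !big_setU1//; split.
- apply: (@measurable_funD _ (gen_type z (j |: J)%SET) R setT (X j) s).
    by apply: (gen_measurableS _ (mX j)); rewrite finset.sub1set !inE eqxx.
  by apply: (gen_measurableS _ ms); exact: finset.subsetUr.
- by split; [exact: sqintD|rewrite ExD// X0 s0 addr0].
- by rewrite ExD// ExD// ExZ// E11 s2 s0 !mulr0 add0r.
- by apply: intgD => //; exact: iX3.
- rewrite ExD//.
  by rewrite ExD// ExD// !ExZ// E21 E12 s3 s0 X0 !mulr0 mul0r !mulr0 !add0r.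
Qed.

(** * Negative moments of partial sums *)

Variables (alpha M : R).
Hypothesis alpha0 : 0 < alpha.
Hypothesis M1 : 1 <= M.
Hypothesis zpos : {ae P, forall w, forall j, 0 < z j w}.
Hypothesis iza : forall j, intg P (fun w => z j w `^ (- alpha)).
Hypothesis Eza : forall j, Ex P (fun w => z j w `^ (- alpha)) <= M.

Let M0 : 0 < M. Proof. exact: lt_le_trans M1. Qed.

(** Jensen for the concave power t / [alpha], made pointwise: the tangent at 1 is applied to the
    negative power of order [alpha] divided by [M], whose mean is at most 1. *)
Lemma coord_neg_moment j (t : R) : 0 <= t -> t <= alpha ->
  intg P (fun w => z j w `^ (- t)) /\ Ex P (fun w => z j w `^ (- t)) <= M `^ (t / alpha).
Proof.
move=> t0 ta; set th := t / alpha.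
have th0 : 0 <= th by rewrite divr_ge0// ltW.
have th1 : th <= 1 by rewrite ler_pdivrMr// mul1r.
pose Y w := M `^ th * (1 + th * (M^-1 * z j w `^ (- alpha) - 1)).
have iY : intg P Y.
  apply: intgZ; apply: intgD; first exact: intg_cst.
  by apply: intgZ; apply: intgB; [exact: intgZ|exact: intg_cst].
have mt : measurable_fun setT (fun w => z j w `^ (- t)).
  exact: (measurableT_comp (measurable_powR _)).
have le : {ae P, forall w, z j w `^ (- t) <= Y w}.
  apply: filterS zpos => w /(_ j) zj.
  have -> : z j w `^ (- t) = M `^ th * (M^-1 * z j w `^ (- alpha)) `^ th.
    rewrite -powRM ?mulr_ge0 ?invr_ge0 ?powR_ge0 ?(ltW M0)//.
    rewrite mulVKf ?gt_eqF// -powRrM; congr (_ `^ _).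
    by rewrite /th; field; exact: lt0r_neq0.
  rewrite ler_wpM2l ?powR_ge0//; apply: powR_bernoulli => //.
  by rewrite mulr_gt0 ?invr_gt0 ?powR_gt0.
have it : intg P (fun w => z j w `^ (- t)).
  by apply: (intg_dom mt iY); apply: filterS le => w; rewrite ger0_norm ?powR_ge0.
split => //; apply: (le_trans (Ex_le it iY le)).
rewrite ExZ; last first.
  apply: intgD; first exact: intg_cst.
  by apply: intgZ; apply: intgB; [exact: intgZ|exact: intg_cst].
rewrite ExD ?Ex_cst; [|exact: intg_cst|
  by apply: intgZ; apply: intgB; [exact: intgZ|exact: intg_cst]].
rewrite ExZ; last by apply: intgB; [exact: intgZ|exact: intg_cst].
rewrite ExB ?Ex_cst; [|exact: intgZ|exact: intg_cst].
rewrite ExZ// -[leRHS]mulr1 ler_wpM2l ?powR_ge0//.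
have : M^-1 * Ex P (fun w => z j w `^ (- alpha)) <= 1.
  by rewrite mulrC ler_pdivrMr// mul1r.
nra.
Qed.

(** AM-GM spreads the order [r] evenly over the coordinates, so each needs only r / #|J|, at most
    [alpha]. The resulting powers of [M] multiply to a bound that does not depend on the size of
    [J]. *)
Lemma sum_neg_moment J (r : R) : (0 < #|J|)%N -> 0 <= r -> r <= alpha * #|J|%:R ->
  let Y w := ((\sum_(j in J) z j w) / #|J|%:R) `^ (- r) in
  [/\ gen_measurable z J Y, intg P Y & Ex P Y <= M `^ (r / alpha)].
Proof.
move=> J0 r0 ra Y.
have n0 : (0 : R) < #|J|%:R by rewrite ltr0n.
set t := r / #|J|%:R.
have t0 : 0 <= t by rewrite divr_ge0// ltW.
have ta : t <= alpha by rewrite ler_pdivrMr.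
have [_ iP EP] := @indep_prod J (fun j w => z j w `^ (- t))
  (fun j => gen_measurable_powR_comp (- t) (@gen_measurable_single j))
  (fun j => (coord_neg_moment j t0 ta).1).
have mY : gen_measurable z J Y.
  apply: gen_measurable_powR_comp.
  apply: (@measurable_funM _ (gen_type z J) R setT (fun w => \sum_(j in J) z j w)) => //.
  exact: gen_measurable_sum.
have le : {ae P, forall w, Y w <= \prod_(j in J) z j w `^ (- t)}.
  by apply: filterS zpos => w zw; exact: mean_powR_neg.
have iY : intg P Y.
  apply: (intg_dom (gen_measurableT mz mY) iP); apply: filterS le => w.
  by rewrite ger0_norm ?powR_ge0.
split => //; apply: (le_trans (Ex_le iY iP le)); rewrite EP.
have -> : M `^ (r / alpha) = \prod_(j in J) M `^ (t / alpha).
  rewrite prodr_const -powR_mulrn ?powR_ge0// -powRrM; congr (_ `^ _).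
  by rewrite /t; field; rewrite !lt0r_neq0.
apply: ler_prod => j _; rewrite (coord_neg_moment j t0 ta).2 andbT.
by apply: Ex_ge0 => w; exact: powR_ge0.
Qed.

Variable m : 'I_d -> R.
Hypothesis sz : forall j, sqint P (z j).
Hypothesis zm : forall j, Ex P (z j) = m j.
Hypothesis iz3 : forall j, intg P (fun w => (z j w - m j) ^+ 3).
Hypothesis m0 : forall j, 0 < m j.

Let x (j : 'I_d) (w : T) : R := z j w - m j.
Let v2 (j : 'I_d) : R := Ex P (fun w => x j w ^+ 2).
Let S (J : {set 'I_d}) (w : T) : R := \sum_(j in J) z j w.

Lemma gen_measurable_centered j : gen_measurable z [set j]%SET (x j).
Proof.
apply: (@measurable_funB _ (gen_type z [set j]%SET) R setT (z j)).
  exact: gen_measurable_single.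
exact: measurable_cst.
Qed.

Lemma sqint_centered j : sqint P (x j).
Proof. by apply: sqintB => //; exact: sqint_cst. Qed.

Lemma Ex_centered j : Ex P (x j) = 0.
Proof. by rewrite ExB ?Ex_cst ?zm ?subrr//; [exact: sqint_intg|exact: intg_cst]. Qed.

Let csm J := centered_sum_moments J gen_measurable_centered sqint_centered iz3 Ex_centered.

Lemma sum_centered J w : \sum_(j in J) x j w = S J w - \sum_(j in J) m j.
Proof. by rewrite /x sumrB. Qed.

Lemma sum_gt0 J w : (0 < #|J|)%N -> (forall j, 0 < z j w) -> 0 < S J w.
Proof.
move=> /card_gt0P[j jJ] zw; rewrite /S (bigD1 j)//=; apply: ltr_pwDl => //.
by apply: sumr_ge0 => i _; exact: ltW.
Qed.

Lemma gen_measurable_scaled_powR J (mu r : R) :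
  gen_measurable z J (fun w => (S J w / mu) `^ r).
Proof.
apply: gen_measurable_powR_comp.
apply: (@measurable_funM _ (gen_type z J) R setT (S J)); last exact: measurable_cst.
exact: gen_measurable_sum.
Qed.

(** In the application [mu] is the mean of the full sum while [J] holds only a fraction of the
    coordinates; [K0] absorbs the ratio. *)
Lemma neg_moment_scaled J (mu K0 s : R) : (0 < #|J|)%N -> 0 <= s -> s <= alpha * #|J|%:R ->
  0 < mu -> mu <= K0 * #|J|%:R ->
  let Y w := (S J w / mu) `^ (- s) in
  intg P Y /\ Ex P Y <= K0 `^ s * M `^ (s / alpha).
Proof.
move=> J0 s0 sa mu0 muK Y.
have n0 : (0 : R) < #|J|%:R by rewrite ltr0n.
have K00 : 0 < K0 by rewrite -(pmulr_lgt0 _ n0); exact: lt_le_trans muK.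
have [mW iW EW] := sum_neg_moment J0 s0 sa.
set W := fun w => ((\sum_(j in J) z j w) / #|J|%:R) `^ (- s) in mW iW EW.
have mY := gen_measurableT mz (@gen_measurable_scaled_powR J mu (- s)).
have le : {ae P, forall w, Y w <= K0 `^ s * W w}.
  apply: filterS zpos => w zw.
  have S0 := sum_gt0 J0 zw.
  have -> : K0 `^ s * W w = (K0^-1 * (S J w / #|J|%:R)) `^ (- s).
    rewrite powRM ?invr_ge0 ?divr_ge0 ?(ltW K00) ?(ltW S0) ?(ltW n0)//; congr (_ * _).
    by rewrite -powR_inv1 ?(ltW K00)// -powRrM; congr (_ `^ _); ring.
  apply: ler_powR_neg; first by rewrite oppr_le0.
    by rewrite mulr_gt0 ?invr_gt0 ?divr_gt0.
  rewrite mulrCA; apply: ler_wpM2l; first exact: ltW.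
  by rewrite -invfM lef_pV2 ?posrE// mulr_gt0.
have iKW : intg P (fun w => K0 `^ s * W w) by exact: intgZ.
have iY : intg P Y.
  apply: (intg_dom mY iKW); apply: filterS le => w.
  by rewrite ger0_norm ?powR_ge0.
split => //; apply: (le_trans (Ex_le iY iKW le)).
by rewrite ExZ// ler_wpM2l ?powR_ge0.
Qed.

(* In the remainder of the Taylor expansion, the centered sum over J1 is independent of the
   sum over J2, which bounds the whole sum from below, and conversely; hence no joint
   moments have to be estimated. *)
Lemma neg_moment_expand J1 J2 (mu q K : R) : [disjoint J1 & J2]%B ->
  (0 < #|J1|)%N -> (0 < #|J2|)%N -> 0 < q -> 0 < mu ->
  (forall J, J = J1 \/ J = J2 -> intg P (fun w => (S J w / mu) `^ (- q - 2)) /\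
     Ex P (fun w => (S J w / mu) `^ (- q - 2)) <= K) ->
  let c := mu - \sum_(j in (J1 :|: J2)%SET) m j in
  let V := \sum_(j in (J1 :|: J2)%SET) v2 j in
  let Y w := (S (J1 :|: J2) w / mu) `^ (- q) in
  intg P Y /\ Ex P Y <= 1 + q * (c / mu) + q * (q + 1) * (3 / mu ^+ 2 * ((V + c ^+ 2) * (1 + K))).
Proof.
move=> dis J10 J20 q0 mu0 hK c V Y.
have [iY1 K1] := hK J1 (or_introl erefl).
have [iY2 K2] := hK J2 (or_intror erefl).
set Y1 := fun w => (S J1 w / mu) `^ (- q - 2) in iY1 K1.
set Y2 := fun w => (S J2 w / mu) `^ (- q - 2) in iY2 K2.
pose D1 w := \sum_(j in J1) x j w.
pose D2 w := \sum_(j in J2) x j w.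
have [mD1 [[_ iD1] ED1] VD1 _ _] := csm J1.
have [mD2 [[_ iD2] ED2] VD2 _ _] := csm J2.
have [_ [sD ED] _ _ _] := csm (J1 :|: J2)%SET.
rewrite -/D1 in mD1 iD1 ED1 VD1; rewrite -/D2 in mD2 iD2 ED2 VD2.
have mD1' : gen_measurable z J1 (fun w => D1 w ^+ 2).
  exact: (@measurable_funX _ (gen_type z J1)).
have mD2' : gen_measurable z J2 (fun w => D2 w ^+ 2).
  exact: (@measurable_funX _ (gen_type z J2)).
have mY1 := @gen_measurable_scaled_powR J1 mu (- q - 2).
have mY2 := @gen_measurable_scaled_powR J2 mu (- q - 2).
have dis' : [disjoint J2 & J1]%B by rewrite disjoint_sym.
have [i12 E12] : intg P (fun w => D1 w ^+ 2 * Y2 w) /\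
    Ex P (fun w => D1 w ^+ 2 * Y2 w) = Ex P (fun w => D1 w ^+ 2) * Ex P Y2.
  exact: (indep_intg_prod mz zI dis mD1' mY2 iD1 iY2).
have [i21 E21] : intg P (fun w => D2 w ^+ 2 * Y1 w) /\
    Ex P (fun w => D2 w ^+ 2 * Y1 w) = Ex P (fun w => D2 w ^+ 2) * Ex P Y1.
  exact: (indep_intg_prod mz zI dis' mD2' mY1 iD2 iY1).
have SU w : S (J1 :|: J2)%SET w = S J1 w + S J2 w.
  rewrite /S (eq_bigl [predU J1 & J2]); last by move=> j; rewrite !inE.
  by rewrite bigU.
have VE : V = Ex P (fun w => D1 w ^+ 2) + Ex P (fun w => D2 w ^+ 2).
  rewrite VD1 VD2 /V (eq_bigl [predU J1 & J2]); last by move=> j; rewrite !inE.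
  by rewrite bigU.
pose D w := \sum_(j in (J1 :|: J2)%SET) x j w.
have DE w : D w = D1 w + D2 w.
  rewrite /D (eq_bigl [predU J1 & J2]); last by move=> j; rewrite !inE.
  by rewrite bigU.
have yE w : S (J1 :|: J2)%SET w = D w - c + mu.
  by rewrite /D sum_centered /c; ring.
have iD : intg P D := sqint_intg sD.
pose B w := D1 w ^+ 2 + (D2 w ^+ 2 + (c ^+ 2 + (D1 w ^+ 2 * Y2 w +
  (D2 w ^+ 2 * Y1 w + c ^+ 2 * Y2 w)))).
have ic := intg_cst P (c ^+ 2); have icY := intgZ (c ^+ 2) iY2.
have ib1 := intgD i21 icY; have ib2 := intgD i12 ib1; have ib3 := intgD ic ib2.
have ib4 := intgD iD2 ib3.
have iB : intg P B by exact: intgD.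
have V1 : 0 <= Ex P (fun w => D1 w ^+ 2) by exact: Ex_sqr_ge0.
have V2 : 0 <= Ex P (fun w => D2 w ^+ 2) by exact: Ex_sqr_ge0.
have EB : Ex P B <= (V + c ^+ 2) * (1 + K).
  rewrite ExD// ExD// ExD// ExD// ExD// ExZ// Ex_cst E12 E21 VE.
  have c2 := sqr_ge0 c.
  have h1 := ler_wpM2l V1 K2; have h2 := ler_wpM2l V2 K1; have h3 := ler_wpM2l c2 K2.
  exact: ler_add_weighted.
pose G w := 1 + ((- q / mu) * (D w - c) + q * (q + 1) * (3 / mu ^+ 2) * B w).
have iDc : intg P (fun w => D w - c) by apply: intgB => //; exact: intg_cst.
have ig1 := intgZ (- q / mu) iDc; have ig2 := intgZ (q * (q + 1) * (3 / mu ^+ 2)) iB.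
have ig3 := intgD ig1 ig2.
have iG : intg P G by apply: intgD => //; exact: intg_cst.
have mY := gen_measurableT mz (@gen_measurable_scaled_powR (J1 :|: J2)%SET mu (- q)).
have le : {ae P, forall w, Y w <= G w}.
  apply: filterS zpos => w zw.
  have s1 := sum_gt0 J10 zw; have s2 := sum_gt0 J20 zw.
  have sE : S J1 w + S J2 w = D1 w + D2 w - c + mu by rewrite -SU yE DE.
  by rewrite /Y /G /B SU DE; exact: powR_neg_split.
have iY : intg P Y.
  apply: (intg_dom mY iG); apply: filterS le => w.
  by rewrite ger0_norm ?powR_ge0.
split => //; apply: (le_trans (Ex_le iY iG le)).
rewrite ExD ?Ex_cst//; last exact: intg_cst.
rewrite ExD// ExZ// ExZ// ExB//; last exact: intg_cst.
rewrite Ex_cst [Ex P D]ED -addrA lerD2l.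
(* The centered sum has mean 0, so the first-order term leaves only the bias [c]. *)
have -> : - q / mu * (0 - c) = q * (c / mu) by ring.
rewrite lerD2l -mulrA; apply: ler_wpM2l.
  by rewrite mulr_ge0 ?addr_ge0 ?ler01 ?(ltW q0).
by apply: ler_wpM2l => //; rewrite divr_ge0 ?sqr_ge0 ?ler0n.
Qed.

(** * Integrability, pair residual and variance of the power of the sum *)

Section power_of_sum.
Variables (p mu : R).
Hypothesis p1 : p < 1.
Hypothesis mu0 : 0 < mu.
Let F (w : T) : R := ((\sum_j z j w) / mu) `^ p.

(** Stated for any [X] above [S J], so that one negative moment serves all four corners of the mixed
    second difference, where coordinates are kept or replaced by their means. *)
Lemma sqint_power_shift J u (X : T -> R) : (0 < #|J|)%N ->
  intg P (fun w => (S J w / mu) `^ (2 * p - 4)) ->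
  gen_measurable z u X -> sqint P X -> {ae P, forall w, S J w <= X w} ->
  gen_measurable z u (fun w => (X w / mu) `^ p) /\ sqint P (fun w => (X w / mu) `^ p).
Proof.
move=> J0 iJ mX [_ iX] JX.
have mXp : gen_measurable z u (fun w => (X w / mu) `^ p).
  apply: gen_measurable_powR_comp.
  by apply: (@measurable_funM _ (gen_type z u) R setT X) => //; exact: measurable_cst.
split => //.
have i2 := intgD (intgZ (mu ^- 2) iX) iJ.
apply: (sqint_dom (gen_measurableT mz mXp) i2).
apply: filterS2 zpos JX => w zw JXw.
have S0 := sum_gt0 J0 zw.
have X0 : 0 < X w / mu by rewrite divr_gt0//; exact: lt_le_trans JXw.
apply: (le_trans (powR_sqr_bound p1 X0)); apply: lerD.
  by rewrite exprMn exprVn mulrC.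
apply: ler_powR_neg; [exact: power_exponent_le0|exact: divr_gt0|].
by rewrite ler_pM2r ?invr_gt0.
Qed.

(* With q1 free of z_i and q2 free of z_j, the residual is the mixed second difference of
   x |-> (x / mu)^p in z_i and z_j around their means. *)
Lemma power_pair_bound (i j : 'I_d) : i != j ->
  let J := (~: [set i; j])%SET in
  let W w := (S J w / mu) `^ (2 * p - 4) in
  (0 < #|J|)%N -> intg P W ->
  sqint P F /\ exists q1 q2,
    [/\ gen_measurable z (~: [set i]%SET) q1, sqint P q1,
        gen_measurable z (~: [set j]%SET) q2, sqint P q2 &
        Ex P (fun w => (F w - q1 w - q2 w) ^+ 2) <=
          p ^+ 2 * (p - 1) ^+ 2 / mu ^+ 4 * (v2 i * v2 j * Ex P W)].
Proof.
move=> ij J W J0 iW.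
have iJ : i \notin J by rewrite !inE eqxx.
have jJ : j \notin J by rewrite !inE eqxx orbT.
have sS u : sqint P (S u) by apply: sqint_sum => k _; exact: sz.
have SE w : \sum_k z k w = S J w + z i w + z j w.
  rewrite (bigID (mem J))/= -addrA; congr (_ + _).
  rewrite (eq_bigl (fun k => (k == i) || (k == j))); last by move=> k; rewrite !inE negbK.
  rewrite (bigD1 i) ?eqxx//=; congr (_ + _).
  rewrite (big_pred1 j)// => k /=.
  by case: (eqVneq k i) => [->|]; rewrite ?(negbTE ij) ?andbT ?andbF ?orbF.
have mS u v : u \subset v -> gen_measurable z v (S u) by exact: gen_measurable_sum.
have zz u k : k \in u -> gen_measurable z u (z k) by exact: gen_measurable_coord.
have addm u (X Y : T -> R) : gen_measurable z u X -> gen_measurable z u Y ->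
    gen_measurable z u (fun w => X w + Y w).
  by move=> mX mY; exact: (@measurable_funD _ (gen_type z u) R setT X Y).
have add3 u (X Y Z : T -> R) : gen_measurable z u X -> gen_measurable z u Y ->
    gen_measurable z u Z -> gen_measurable z u (fun w => X w + Y w + Z w).
  by move=> mX mY mZ; apply: (addm) => //; exact: addm.
have subm u (X Y : T -> R) : gen_measurable z u X -> gen_measurable z u Y ->
    gen_measurable z u (fun w => X w - Y w).
  by move=> mX mY; exact: (@measurable_funB _ (gen_type z u) R setT X Y).
have cm u (c : R) : gen_measurable z u (fun=> c : R) by exact: measurable_cst.
have Ji : J \subset ~: [set i]%SET by rewrite finset.setCS finset.subsetUl.
have Jj : J \subset ~: [set j]%SET by rewrite finset.setCS finset.subsetUr.
have ji : j \in ~: [set i]%SET by rewrite !inE eq_sym.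
have ij' : i \in ~: [set j]%SET by rewrite !inE.
have [|||mF sF] := @sqint_power_shift J finset.setT (fun w => S J w + z i w + z j w) J0 iW.
- by apply: add3; [exact: mS (finset.subsetT _)|exact: zz (finset.in_setT _)..].
- by apply: sqintD => //; exact: sqintD.
- by apply: filterS zpos => w zw; rewrite -addrA lerDl addr_ge0// ltW.
have [|||m1 s1] := @sqint_power_shift J (~: [set i]%SET) (fun w => S J w + m i + z j w) J0 iW.
- by apply: add3 => //; [exact: mS|exact: zz].
- by apply: sqintD => //; apply: sqintD => //; exact: sqint_cst.
- by apply: filterS zpos => w zw; rewrite -addrA lerDl addr_ge0// ltW.
have [|||m2 s2] := @sqint_power_shift J (~: [set j]%SET) (fun w => S J w + z i w + m j) J0 iW.
- by apply: add3 => //; [exact: mS|exact: zz].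
- by apply: sqintD => //; [exact: sqintD|exact: sqint_cst].
- by apply: filterS zpos => w zw; rewrite -addrA lerDl addr_ge0// ltW.
have [|||m3 s3] := @sqint_power_shift J (~: [set j]%SET) (fun w => S J w + m i + m j) J0 iW.
- by apply: add3 => //; exact: mS.
- by apply: sqintD => //; [apply: sqintD => //; exact: sqint_cst|exact: sqint_cst].
- by apply: filterS zpos => w zw; rewrite -addrA lerDl addr_ge0// ltW.
have FE : F = fun w => ((S J w + z i w + z j w) / mu) `^ p.
  by apply/funext => w; rewrite /F SE.
rewrite FE; split => //.
exists (fun w => ((S J w + m i + z j w) / mu) `^ p).
exists (fun w => ((S J w + z i w + m j) / mu) `^ p - ((S J w + m i + m j) / mu) `^ p).
split => //; [exact: subm|exact: sqintB|].
have dij : [disjoint [set i]%SET & [set j]%SET]%B.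
  by rewrite finset.disjoints_subset finset.sub1set !inE.
have x2 k : gen_measurable z [set k]%SET (fun w => x k w ^+ 2).
  exact: (@measurable_funX _ (gen_type z [set k]%SET) R setT (x k) 2 (@gen_measurable_centered k)).
have [_ ixi] := sqint_centered i; have [_ ixj] := sqint_centered j.
have [iij Eij] := indep_intg_prod mz zI dij (@x2 i) (@x2 j) ixi ixj.
have dJ : [disjoint [set i; j]%SET & J]%B by rewrite finset.disjoints_subset finset.setCK.
have mij : gen_measurable z [set i; j]%SET (fun w => x i w ^+ 2 * x j w ^+ 2).
  apply: (@measurable_funM _ (gen_type z [set i; j]%SET) R setT).
    by apply: (gen_measurableS _ (@x2 i)); rewrite finset.sub1set !inE eqxx.
  by apply: (gen_measurableS _ (@x2 j)); rewrite finset.sub1set !inE eqxx orbT.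
have [iij3 E3] := indep_intg_prod mz zI dJ mij
  (@gen_measurable_scaled_powR J mu (2 * p - 4)) iij iW.
have iB := intgZ (p ^+ 2 * (p - 1) ^+ 2 / mu ^+ 4) iij3.
rewrite /v2 -Eij -E3 -ExZ//.
have [_ iL] := sqintB (sqintB sF s1) (sqintB s2 s3).
apply: (Ex_le iL iB); apply: filterS zpos => w zw.
have S0 := sum_gt0 J0 zw.
have h k : 0 < z k w / mu by rewrite divr_gt0.
have hm k : 0 < m k / mu by rewrite divr_gt0.
have S0' : 0 < S J w / mu by rewrite divr_gt0.
have := powR_second_difference p1 S0' (h i) (h j) (hm i) (hm j).
rewrite -!mulrDl -!mulrBl => H.
have -> : ((S J w + z i w + z j w) / mu) `^ p - ((S J w + m i + z j w) / mu) `^ p -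
   (((S J w + z i w + m j) / mu) `^ p - ((S J w + m i + m j) / mu) `^ p) =
  ((S J w + z i w + z j w) / mu) `^ p - ((S J w + m i + z j w) / mu) `^ p -
   ((S J w + z i w + m j) / mu) `^ p + ((S J w + m i + m j) / mu) `^ p by ring.
apply: (le_trans H); rewrite le_eqVlt; apply/orP; left; apply/eqP.
by rewrite /x /W; field; exact: lt0r_neq0.
Qed.

(** With h = (F - 1) / p and e the relative deviation of the sum from its mean, Var(h - e) >= 0
    gives Var(h) >= 2 E(h e) - E(e^2). The pointwise inequality bounds E(h e) from below; doubling
    turns its coefficient (p - 1) / 2 into p - 1. *)
Lemma variance_power_lower : p != 0 -> mu = \sum_j m j -> (0 < d)%N -> sqint P F ->
  p ^+ 2 * (\sum_j v2 j / mu ^+ 2 +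
      (p - 1) * (\sum_j Ex P (fun w => x j w ^+ 3) / mu ^+ 3)) <= fine 'V_P[F].
Proof.
move=> p0 muE d0 sF.
have [mD [sD ED] VD iD3 ED3] := csm finset.setT.
pose D w := \sum_(j in finset.setT) x j w.
rewrite -/D in mD sD ED VD iD3 ED3.
have all (G : 'I_d -> R) : \sum_(j in finset.setT) G j = \sum_j G j.
  by apply: eq_bigl => j; rewrite inE.
rewrite !all in VD ED3.
pose e w := mu^-1 * D w.
have se : sqint P e by exact: sqintZ.
have E0 : Ex P e = 0 by rewrite ExZ ?ED ?mulr0//; exact: sqint_intg.
have e2 : Ex P (fun w => e w ^+ 2) = \sum_j v2 j / mu ^+ 2.
  have -> : (fun w => e w ^+ 2) = fun w => mu ^- 2 * D w ^+ 2.
    by apply/funext => w; rewrite /e exprMn exprVn.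
  by rewrite ExZ; [rewrite VD mulrC mulr_suml|case: sD].
have e3E : (fun w => e w ^+ 3) = fun w => mu ^- 3 * D w ^+ 3.
  by apply/funext => w; rewrite /e exprMn exprVn.
have ie3 : intg P (fun w => e w ^+ 3) by rewrite e3E; exact: intgZ.
have e3 : Ex P (fun w => e w ^+ 3) = \sum_j Ex P (fun w => x j w ^+ 3) / mu ^+ 3.
  by rewrite e3E ExZ// ED3 mulrC mulr_suml.
pose h w := p^-1 * (F w - 1).
have sh : sqint P h by apply: sqintZ; apply: sqintB => //; exact: sqint_cst.
have ish := sqint_intg sh; have isF := sqint_intg sF.
have [_ ih2] := sh; have [_ ie2] := se.
have ihe : intg P (fun w => h w * e w) by exact: intgM.
have key : Ex P (fun w => e w ^+ 2) + (p - 1) / 2 * Ex P (fun w => e w ^+ 3)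
    <= Ex P (fun w => h w * e w).
  rewrite -ExZ// -ExD//; last exact: intgZ.
  apply: Ex_le => //; first by apply: intgD => //; exact: intgZ.
  apply: filterS zpos => w zw.
  have S0 : 0 < S finset.setT w.
    by apply: sum_gt0 => //; rewrite cardsT card_ord.
  have := powR_centered_mul p1 p0 (divr_gt0 S0 mu0).
  have -> : S finset.setT w / mu - 1 = e w.
    by rewrite /e /D sum_centered all -muE; field; exact: lt0r_neq0.
  by rewrite /h /F /S all [p^-1 * _]mulrC.
have Vh : fine 'V_P[F] = p ^+ 2 * (Ex P (fun w => h w ^+ 2) - Ex P h ^+ 2).
  rewrite (variance_Ex sF)/=.
  have FE : F = fun w => 1 + p * h w.
    by apply/funext => w; rewrite /h mulrA divff// mul1r addrC subrK.
  have F2E : (fun w => F w ^+ 2) = fun w => 1 + (2 * p * h w + p ^+ 2 * h w ^+ 2).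
    by apply/funext => w; rewrite {1}FE; ring.
  have i1 := intgZ (2 * p) ish; have i2 := intgZ (p ^+ 2) ih2; have i3 := intgD i1 i2.
  have -> : Ex P F = 1 + p * Ex P h.
    rewrite FE ExD; [|exact: intg_cst|exact: intgZ].
    by rewrite Ex_cst ExZ.
  rewrite F2E ExD ?Ex_cst//; last exact: intg_cst.
  by rewrite (ExD i1 i2) (ExZ (2 * p) ish) (ExZ (p ^+ 2) ih2); ring.
have var0 : 0 <= Ex P (fun w => h w ^+ 2) - 2 * Ex P (fun w => h w * e w)
    + Ex P (fun w => e w ^+ 2) - Ex P h ^+ 2.
  have := Ex_sqr_ge0 P (fun w => (h w - e w) - Ex P h).
  have -> : (fun w => (h w - e w - Ex P h) ^+ 2) = fun w => h w ^+ 2 +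
     (e w ^+ 2 + (Ex P h ^+ 2 + (- 2 * (h w * e w) + (- 2 * Ex P h * h w + 2 * Ex P h * e w)))).
    by apply/funext => w; ring.
  have ise := sqint_intg se.
  have j1 := intgD (intgZ (- 2 * Ex P h) ish) (intgZ (2 * Ex P h) ise).
  have j2 := intgD (intgZ (- 2) ihe) j1.
  have j3 := intgD (intg_cst P (Ex P h ^+ 2)) j2; have j4 := intgD ie2 j3.
  rewrite ExD// ExD// ExD//; last exact: intg_cst.
  rewrite ExD//; last exact: intgZ.
  rewrite ExD; [|exact: intgZ|exact: intgZ].
  rewrite (ExZ (- 2) ihe) (ExZ (- 2 * Ex P h) ish) (ExZ (2 * Ex P h) ise) Ex_cst E0.
  by congr (0 <= _); ring.
rewrite Vh ler_wpM2l ?sqr_ge0//.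
by rewrite e2 e3 in key; rewrite e2 in var0; exact: ler_variance_lower key var0.
Qed.

End power_of_sum.

End moments.

(** * Assembling the bound *)

Lemma set_halves (I : finType) (J : {set I}) : exists J1 J2 : {set I},
  [/\ [disjoint J1 & J2]%B, J = (J1 :|: J2)%SET, #|J1| = #|J|./2 & #|J2| = (#|J| - #|J|./2)%N].
Proof.
pose J1 : {set I} := [set x in take #|J|./2 (enum J)]%SET.
have J1J : J1 \subset J.
  by apply/fintype.subsetP => x; rewrite inE => /mem_take; rewrite mem_enum.
have cJ1 : #|J1| = #|J|./2.
  rewrite cardsE (card_uniqP _) ?take_uniq ?enum_uniq// size_takel// -cardE.
  by rewrite -{2}(odd_double_half #|J|) -addnn addnCA leq_addr.
exists J1, (J :\: J1)%SET; split => //.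
- by rewrite finset.disjoints_subset; apply/fintype.subsetP => x; rewrite !inE => ->.
- by rewrite -{1}(finset.setID J J1) (finset.setIidPr J1J).
- by rewrite cardsD (finset.setIidPr J1J) cJ1.
Qed.

(** After removal of two coordinates, each half of the rest still holds a quarter of all of them.
    This explains the threshold 6 (at d = 5 the smaller half is a single element) and the factors 4
    in [K] and [d_exponent]. *)
Lemma quarter_le d : (6 <= d)%N ->
  (d <= 4 * (d - 2)./2)%N /\ (d <= 4 * (d - 2 - (d - 2)./2))%N.
Proof. by move=> d6; split; lia. Qed.

(** * Scalar estimates and the origin of the constants *)

Section real_algebra.
Context {R : realType}.
Implicit Types (p q lam lo hi K c V mu D s kap C a b : R).

(* K bounds the moments of order - q - 2 of both halves of the remaining coordinates. *)
Definition pair_const q lam lo hi K : R :=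
  2 * q * hi / lo + 3 * q * (q + 1) * (lam + 4 * hi ^+ 2) * (1 + K) / lo ^+ 2.

Lemma pair_const_bound q lam lo hi K c V mu D :
  0 < q -> 0 < lo -> 0 <= hi -> 0 <= lam -> 0 <= K -> 1 <= D -> lo * D <= mu ->
  0 <= c -> c <= 2 * hi -> 0 <= V -> V <= D * lam ->
  1 + q * (c / mu) + q * (q + 1) * (3 / mu ^+ 2 * ((V + c ^+ 2) * (1 + K)))
    <= 1 + pair_const q lam lo hi K / D.
Proof.
move=> q0 lo0 hi0 lam0 K0 D1 muD c0 chi V0 VD.
have D0 : 0 < D by exact: lt_le_trans D1.
have loD : 0 < lo * D by exact: mulr_gt0.
have mu0 : 0 < mu by exact: lt_le_trans muD.
have h1 : c / mu <= 2 * hi / (lo * D).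
  by apply: ler_pM => //; rewrite ?invr_ge0 ?(ltW mu0)// lef_pV2.
have h2 : mu ^- 2 <= (lo * D) ^- 2.
  rewrite lef_pV2 ?posrE ?exprn_gt0// ler_pXn2r// nnegrE; exact: ltW.
(* A crude bound by [1 <= D], which puts the bounded bias on the same scale as [V]. *)
have c2 : c ^+ 2 <= D * (4 * hi ^+ 2).
  have : c ^+ 2 <= 4 * hi ^+ 2.
    have -> : 4 * hi ^+ 2 = (2 * hi) ^+ 2 by ring.
    by rewrite ler_pXn2r ?nnegrE// mulr_ge0.
  have : 0 <= hi ^+ 2 by exact: sqr_ge0.
  by move: (hi ^+ 2) (c ^+ 2) => x y x0 yx; nra.
have h3 : (V + c ^+ 2) * (1 + K) <= D * (lam + 4 * hi ^+ 2) * (1 + K).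
  by apply: ler_wpM2r; [lra|rewrite mulrDr; lra].
have h4 : 3 / mu ^+ 2 * ((V + c ^+ 2) * (1 + K)) <=
    3 / (lo * D) ^+ 2 * (D * (lam + 4 * hi ^+ 2) * (1 + K)).
  apply: ler_pM => //.
  - by rewrite divr_ge0// sqr_ge0.
  - by rewrite mulr_ge0 ?addr_ge0 ?sqr_ge0.
  - by rewrite ler_wpM2l.
have -> : 1 + pair_const q lam lo hi K / D = 1 + q * (2 * hi / (lo * D)) +
    q * (q + 1) * (3 / (lo * D) ^+ 2 * (D * (lam + 4 * hi ^+ 2) * (1 + K))).
  by rewrite /pair_const; field; rewrite !lt0r_neq0.
apply: lerD; first by rewrite lerD2l ler_wpM2l// ltW.
by rewrite ler_wpM2l// mulr_ge0 ?addr_ge0// ltW.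
Qed.

Lemma cube_le_amgm (t x : R) : 0 < t -> `|x ^+ 3| <= 2^-1 * (t * x ^+ 2 + t^-1 * x ^+ 4).
Proof.
move=> t0; have ti : 0 <= t^-1 by rewrite invr_ge0 ltW.
have h1 : 0 <= t^-1 * (x * (t - x)) ^+ 2 by rewrite mulr_ge0 ?sqr_ge0.
have h2 : 0 <= t^-1 * (x * (t + x)) ^+ 2 by rewrite mulr_ge0 ?sqr_ge0.
have tn : t != 0 by exact: lt0r_neq0.
have e1 : t^-1 * (x * (t - x)) ^+ 2 = t * x ^+ 2 - 2 * x ^+ 3 + t^-1 * x ^+ 4 by field.
have e2 : t^-1 * (x * (t + x)) ^+ 2 = t * x ^+ 2 + 2 * x ^+ 3 + t^-1 * x ^+ 4 by field.
rewrite e1 in h1; rewrite e2 in h2.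
by rewrite ler_norml; apply/andP; split; lra.
Qed.

Lemma third_moment_algebra p lam lo V mu D k3 : p < 1 -> 0 < lo -> 1 <= D ->
  lo * D <= mu -> 0 <= V -> 4 * (1 - p) ^+ 2 * lam / lo ^+ 2 <= D * V ->
  (forall t, 0 < t -> k3 <= 2^-1 * (t * V + t^-1 * (D * lam))) ->
  2 * (1 - p) * k3 <= mu * V.
Proof.
move=> p1 lo0 D1 muD V0 DV H.
have D0 : 0 < D by exact: lt_le_trans D1.
have p0 : 0 < 1 - p by lra.
(* This weight makes the second-moment term exactly half of lo D V. The fourth-moment term becomes a
   constant, which the lower bound on D V makes no larger than the other half. *)
have t0 : 0 < lo * D / (2 * (1 - p)) by rewrite divr_gt0 ?mulr_gt0.
have := ler_wpM2l (ltW (mulr_gt0 (ltr0n R 2) p0)) (H _ t0).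
have -> : 2 * (1 - p) * (2^-1 * (lo * D / (2 * (1 - p)) * V +
    (lo * D / (2 * (1 - p)))^-1 * (D * lam))) =
  2^-1 * (lo * D) * V + lo / 2 * (4 * (1 - p) ^+ 2 * lam / lo ^+ 2).
  by field; rewrite !lt0r_neq0.
move=> h; apply: (le_trans h).
have l2 : 0 <= lo / 2 by rewrite divr_ge0// ltW.
have h1 := ler_wpM2l l2 DV; have h2 := ler_wpM2r V0 muD.
lra.
Qed.

(** [a / D] bounds the squared coefficient of variation of the sum and [b / D ^+ 2] its scaled third
    cumulant. The first summand pays for the factor 1 + C1 / D in the pair bound, the second for the
    skewness term in the variance. *)
Definition asymptotic_const p C1 a b : R :=
  (p - 1) ^+ 2 / 2 * (C1 * a + (1 + C1) * (2 * (1 - p) * b)).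

Lemma mean_dim_algebra p s kap D C1 a b VF : p < 1 -> p != 0 -> 0 < s -> 1 <= D ->
  0 <= C1 -> s <= a / D -> `|kap| <= b / D ^+ 2 -> 2 * (1 - p) * `|kap| <= s ->
  p ^+ 2 * (s + (p - 1) * kap) <= VF ->
  0 < VF /\ 1 + p ^+ 2 * (p - 1) ^+ 2 * s ^+ 2 * (1 + C1 / D) / 2 / VF <=
    1 + (p - 1) ^+ 2 / 2 * s + asymptotic_const p C1 a b / D ^+ 2.
Proof.
move=> p1 p0 s0 D1 C10 sa kb ks hV.
have D0 : 0 < D by exact: lt_le_trans D1.
have Di1 : D^-1 <= 1 by rewrite invf_le1.
have Di0 : 0 < D^-1 by rewrite invr_gt0.
set y := (1 - p) * `|kap|.
have y0 : 0 <= y by rewrite mulr_ge0//; lra.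
have ys : 2 * y <= s by rewrite /y; lra.
have yk : s - y <= s + (p - 1) * kap.
  have h := ler_norm kap; have p1' : 0 <= 1 - p by lra.
  have := ler_wpM2l p1' h; rewrite /y; lra.
have pp : 0 < p ^+ 2 by rewrite exprn_even_gt0.
have VF1 : p ^+ 2 * (s - y) <= VF by apply: le_trans hV; rewrite ler_pM2l.
have VF0 : 0 < VF by apply: lt_le_trans VF1; rewrite mulr_gt0//; lra.
split => //; rewrite -addrA lerD2l.
set Q := (p - 1) ^+ 2 / 2.
have Q0 : 0 <= Q by rewrite divr_ge0// sqr_ge0.
have C1D : 0 <= C1 / D by rewrite divr_ge0// ltW.
apply: (@le_trans _ _ (Q * ((1 + C1 / D) * (s + 2 * y)))).
  rewrite ler_pdivrMr//.
  (* With t = y / s this is 1 / (1 - t) <= 1 + 2t for 0 <= t <= 1/2, freed of denominators. *)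
  have h : s ^+ 2 <= (s + 2 * y) * (s - y).
    have := mulr_ge0 y0 (_ : 0 <= s - 2 * y); rewrite subr_ge0 => /(_ ys); lra.
  have -> : p ^+ 2 * (p - 1) ^+ 2 * s ^+ 2 * (1 + C1 / D) / 2 =
    Q * (1 + C1 / D) * (p ^+ 2 * s ^+ 2) by rewrite /Q; ring.
  have -> : Q * ((1 + C1 / D) * (s + 2 * y)) * VF = Q * (1 + C1 / D) * ((s + 2 * y) * VF).
    by ring.
  apply: ler_wpM2l; first by rewrite mulr_ge0// addr_ge0.
  apply: (@le_trans _ _ (p ^+ 2 * ((s + 2 * y) * (s - y)))); first by rewrite ler_pM2l.
  by rewrite mulrCA ler_wpM2l//; lra.
have -> : Q * s + asymptotic_const p C1 a b / D ^+ 2 =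
    Q * (s + (C1 * (a / D ^+ 2) + (1 + C1) * (2 * (1 - p) * (b / D ^+ 2)))).
  by rewrite /asymptotic_const -/Q; ring.
apply: ler_wpM2l => //.
have h1 : C1 / D * s <= C1 * (a / D ^+ 2).
  rewrite -mulrA ler_wpM2l//.
  have -> : a / D ^+ 2 = D^-1 * (a / D) by field; exact: lt0r_neq0.
  by rewrite ler_pM2l.
have h2 : y <= (1 - p) * (b / D ^+ 2) by rewrite ler_wpM2l//; lra.
have h3 : C1 / D * y <= C1 * ((1 - p) * (b / D ^+ 2)).
  apply: ler_pM => //; rewrite -[leRHS]mulr1; exact: ler_wpM2l.
lra.
Qed.

End real_algebra.

(** * The bound at a fixed, large enough dimension *)

Section fixed_dimension.
Context {dT : measure_display} {T : measurableType dT} {R : realType}.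
Variable P : probability T R.
Variables (d : nat) (z : 'I_d -> T -> R).
Hypothesis mz : forall j, measurable_fun setT (z j).
Hypothesis zI : forall (J : {set 'I_d}) (B : 'I_d -> set R),
  (forall j, measurable (B j)) ->
  (P (\bigcap_(j in [set` J]) z j @^-1` B j) = \prod_(j in J) P (z j @^-1` B j))%E.
Variables (alpha M lo hi lam p : R).
Hypothesis alpha0 : 0 < alpha.
Hypothesis M1 : 1 <= M.
Hypothesis zpos : {ae P, forall w, forall j, 0 < z j w}.
Hypothesis iza : forall j, intg P (fun w => z j w `^ (- alpha)).
Hypothesis Eza : forall j, Ex P (fun w => z j w `^ (- alpha)) <= M.
Variable m : 'I_d -> R.
Hypothesis sz : forall j, sqint P (z j).
Hypothesis zm : forall j, Ex P (z j) = m j.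
Hypothesis iz3 : forall j, intg P (fun w => (z j w - m j) ^+ 3).
Hypothesis iz4 : forall j, intg P (fun w => (z j w - m j) ^+ 4).
Hypothesis lo0 : 0 < lo.
Hypothesis mlo : forall j, lo <= m j.
Hypothesis mhi : forall j, m j <= hi.
Hypothesis v_le : forall j, Ex P (fun w => (z j w - m j) ^+ 2) <= lam.
Hypothesis k3_le : forall j, `|Ex P (fun w => (z j w - m j) ^+ 3)| <= lam.
Hypothesis k4_le : forall j, Ex P (fun w => (z j w - m j) ^+ 4) <= lam.
Hypothesis p1 : p < 1.
Hypothesis p0 : p != 0.
Hypothesis d6 : (6 <= d)%N.

Let v (j : 'I_d) : R := Ex P (fun w => (z j w - m j) ^+ 2).
Let k3 (j : 'I_d) : R := Ex P (fun w => (z j w - m j) ^+ 3).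
Let mu : R := \sum_j m j.
Let V : R := \sum_j v j.
(** The pair bound involves the moment of order [- q]; the Taylor remainder raises this to
    [- q - 2], hence [q + 2] in [K] and in [d_exponent]. *)
Let q : R := 4 - 2 * p.
Let K : R := (4 * hi) `^ (q + 2) * M `^ ((q + 2) / alpha).
Let C1 : R := pair_const q lam lo hi K.
Hypothesis d_exponent : 4 * (q + 2) <= alpha * d%:R.
Hypothesis d_variance : 4 * (1 - p) ^+ 2 * lam / lo ^+ 2 <= d%:R * V.

Let D1 : (1 : R) <= d%:R.
Proof. by rewrite ler1n; exact: leq_trans d6. Qed.

Let q0 : 0 < q. Proof. by rewrite /q; have := p1; lra. Qed.

Let m0 j : 0 < m j. Proof. exact: lt_le_trans (mlo j). Qed.

Let j0 : 'I_d. Proof. exact: (Ordinal (leq_trans (isT : 0 < 6)%N d6)). Qed.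

Let hi0 : 0 < hi. Proof. exact: lt_le_trans (m0 j0) (mhi j0). Qed.

Let v_ge0 j : 0 <= v j. Proof. exact: Ex_sqr_ge0. Qed.

Let lam0 : 0 <= lam. Proof. exact: le_trans (v_ge0 j0) (v_le j0). Qed.

Let sum_ord (F : 'I_d -> R) (c : R) : (forall j, F j <= c) -> \sum_j F j <= d%:R * c.
Proof.
move=> Fc; apply: (@le_trans _ _ (\sum_(j < d) c)); first exact: ler_sum.
by rewrite sumr_const card_ord mulr_natl.
Qed.

Let mu_lo_le : lo * d%:R <= mu.
Proof.
rewrite mulrC mulr_natl -[X in _ *+ X]card_ord -sumr_const.
by apply: ler_sum => j _; exact: mlo.
Qed.

Let mu0 : 0 < mu.
Proof.
apply: lt_le_trans mu_lo_le; rewrite mulr_gt0//.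
exact: lt_le_trans ltr01 D1.
Qed.

Let V_ge0 : 0 <= V. Proof. by apply: sumr_ge0 => j _; exact: v_ge0. Qed.

Lemma pair_exponent (i j : 'I_d) : i != j ->
  let J := (~: [set i; j])%SET in
  let W w := ((\sum_(k in J) z k w) / mu) `^ (2 * p - 4) in
  [/\ (0 < #|J|)%N, intg P W & Ex P W <= 1 + C1 / d%:R].
Proof.
move=> ij J W.
have cJ : #|J| = (d - 2)%N.
  by rewrite /J cardsCs finset.setCK cards2 ij card_ord.
have [J1 [J2 [dis JE c1 c2]]] := set_halves J.
have [q1 q2] := quarter_le d6; rewrite cJ in c1 c2.
rewrite -c1 in q1; rewrite -c2 in q2.
have hJ J' : J' = J1 \/ J' = J2 -> (d <= 4 * #|J'|)%N by case=> ->.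
have hJ0 J' : J' = J1 \/ J' = J2 -> (0 < #|J'|)%N.
  by move=> /hJ h; move: (leq_trans d6 h); case: #|J'|.
have hJR J' : J' = J1 \/ J' = J2 -> (d%:R : R) <= 4 * #|J'|%:R.
  by move=> /hJ h; rewrite -(natrM _ 4) ler_nat.
have hK J' : J' = J1 \/ J' = J2 ->
    intg P (fun w => ((\sum_(k in J') z k w) / mu) `^ (- q - 2)) /\
    Ex P (fun w => ((\sum_(k in J') z k w) / mu) `^ (- q - 2)) <= K.
  move=> J'J; have J'0 := hJ0 _ J'J; have J'R := hJR _ J'J.
  have q20 : 0 <= q + 2 by rewrite addr_ge0// ltW.
  have h1 : q + 2 <= alpha * #|J'|%:R.
    have := le_trans d_exponent (ler_wpM2l (ltW alpha0) J'R).
    by rewrite mulrCA ler_pM2l.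
  have h2 : mu <= 4 * hi * #|J'|%:R.
    have := sum_ord mhi; rewrite -/mu => h; apply: (le_trans h).
    by rewrite [4 * hi]mulrC -mulrA mulrC ler_wpM2l// ltW.
  have -> : - q - 2 = - (q + 2) by ring.
  exact: (neg_moment_scaled mz zI alpha0 M1 zpos iza Eza J'0 q20 h1 mu0 h2).
have [iY EY] := neg_moment_expand mz zI zpos sz zm iz3 dis
  (hJ0 _ (or_introl erefl)) (hJ0 _ (or_intror erefl)) q0 mu0 hK.
have We : 2 * p - 4 = - q by rewrite /q; ring.
rewrite -JE in iY EY; rewrite /W We; split => //.
  by rewrite JE; apply: leq_trans (hJ0 _ (or_introl erefl)) _;
    apply: subset_leq_card; exact: finset.subsetUl.
apply: (le_trans EY).
(* Only two coordinates are missing, so the bias stays bounded and its ratio to [mu] is O(1/d). *)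
have muJ : mu - \sum_(k in J) m k = m i + m j.
  apply/eqP; rewrite subr_eq addrC; apply/eqP.
  rewrite /mu (bigID (mem J))/=; congr (_ + _).
  rewrite (eq_bigl (fun k => (k == i) || (k == j))); last by move=> k; rewrite !inE negbK.
  rewrite (bigD1 i) ?eqxx//=; congr (_ + _).
  rewrite (big_pred1 j)// => k /=.
  by case: (eqVneq k i) => [->|]; rewrite ?(negbTE ij) ?andbT ?andbF ?orbF.
rewrite muJ; apply: pair_const_bound => //.
- exact: ltW.
- by rewrite mulr_ge0// powR_ge0.
- by rewrite addr_ge0// ltW.
- by have := mhi i; have := mhi j; lra.
- by apply: sumr_ge0 => k _; exact: v_ge0.
- apply: le_trans (sum_ord v_le).
  by rewrite [leRHS](bigID (mem J))/= lerDl; apply: sumr_ge0 => k _; exact: v_ge0.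
Qed.

Lemma third_moment_small : 2 * (1 - p) * `|\sum_j k3 j| <= mu * V.
Proof.
apply: (third_moment_algebra p1 lo0 D1 mu_lo_le V_ge0 d_variance) => t t0.
apply: (le_trans (ler_norm_sum _ _ _)).
have h j : `|k3 j| <= 2^-1 * (t * v j + t^-1 * lam).
  have i2 : intg P (fun w => (z j w - m j) ^+ 2).
    by have [] : sqint P (fun w => z j w - m j) by apply: sqintB => //; exact: sqint_cst.
  have i4 := @iz4 j; have i3 := @iz3 j.
  have iB := intgZ 2^-1 (intgD (intgZ t i2) (intgZ t^-1 i4)).
  have EB : Ex P (fun w => 2^-1 * (t * (z j w - m j) ^+ 2 + t^-1 * (z j w - m j) ^+ 4)) <=
      2^-1 * (t * v j + t^-1 * lam).
    rewrite (ExZ _ (intgD (intgZ t i2) (intgZ t^-1 i4))) (ExD (intgZ t i2) (intgZ t^-1 i4)).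
    rewrite (ExZ _ i2) (ExZ _ i4) ler_wpM2l// lerD2l ler_wpM2l ?invr_ge0 ?(ltW t0)//.
  rewrite ler_norml; apply/andP; split.
    rewrite lerNl -(ExN i3); apply: le_trans EB; apply: (Ex_le (intgN i3) iB).
    apply: aeW => w /=; apply: le_trans (cube_le_amgm _ t0).
    by rewrite -normrN ler_norm.
  apply: le_trans EB; apply: (Ex_le i3 iB); apply: aeW => w /=.
  by apply: le_trans (cube_le_amgm _ t0); rewrite ler_norm.
apply: (@le_trans _ _ (\sum_(j < d) (2^-1 * (t * v j + t^-1 * lam)))).
  by apply: ler_sum => j _; exact: h.
rewrite -mulr_sumr big_split /= -mulr_sumr sumr_const card_ord -mulrnAr.
by rewrite -[lam *+ d]mulr_natl.
Qed.

Lemma mean_dim_fixed : 0 < V ->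
  let f := fun x : 'I_d -> R => ((\sum_j x j) / mu) `^ p in
  let fz := fun w => f (fun j => z j w) in
  [/\ sqint P fz, 0 < fine 'V_P[fz] &
    mean_dim P z f <= 1 + (p - 1) ^+ 2 / 2 * (V / mu ^+ 2) +
      asymptotic_const p C1 (lam / lo ^+ 2) (lam / lo ^+ 3) / d%:R ^+ 2].
Proof.
move=> V0 f fz.
have D0 : (0 : R) < d%:R by exact: lt_le_trans ltr01 D1.
have loD : 0 < lo * d%:R by exact: mulr_gt0.
have C10 : 0 <= C1.
  rewrite /C1 /pair_const addr_ge0// divr_ge0 ?sqr_ge0 ?(ltW lo0)//.
    by rewrite !mulr_ge0// ltW.
  have K0 : 0 <= K by rewrite mulr_ge0// powR_ge0.
  apply: mulr_ge0; last exact: addr_ge0.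
  apply: mulr_ge0; last by rewrite addr_ge0// mulr_ge0// sqr_ge0.
  exact: (mulr_ge0 (mulr_ge0 (ler0n _ 3) (ltW q0)) (addr_ge0 (ltW q0) ler01)).
have C1D : 0 <= 1 + C1 / d%:R by rewrite addr_ge0// divr_ge0// ltW.
(* An arbitrary pair: it serves to extract square integrability of the whole power. *)
pose i0 : 'I_d := Ordinal (leq_trans (isT : 0 < 6)%N d6); pose i1 : 'I_d := Ordinal (leq_trans (isT : 1 < 6)%N d6).
have i01 : i0 != i1 by [].
have [J0 iW _] := pair_exponent i01.
have [sF _] := power_pair_bound mz zI zpos sz m0 p1 mu0 i01 J0 iW.
have d0 : (0 < d)%N by exact: leq_trans d6.
have hV := variance_power_lower mz zI zpos sz zm iz3 p1 mu0 p0 erefl d0 sF.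
rewrite -!mulr_suml in hV.
have mu2 : 0 < mu ^+ 2 by rewrite exprn_gt0.
have mu3 : 0 < mu ^+ 3 by rewrite exprn_gt0.
have s0 : 0 < V / mu ^+ 2 by exact: divr_gt0.
have sa : V / mu ^+ 2 <= lam / lo ^+ 2 / d%:R.
  have -> : lam / lo ^+ 2 / d%:R = (d%:R * lam) / (lo * d%:R) ^+ 2.
    by field; rewrite !lt0r_neq0.
  apply: ler_pM => //; first by rewrite invr_ge0 ltW.
    exact: sum_ord.
  by rewrite lef_pV2 ?posrE ?exprn_gt0// ler_pXn2r// nnegrE; exact: ltW.
have kE : `|\sum_j k3 j / mu ^+ 3| = `|\sum_j k3 j| / mu ^+ 3.
  have mui : 0 < (mu ^+ 3)^-1 by rewrite invr_gt0.
  by rewrite -mulr_suml normrM (gtr0_norm mui).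
have kb : `|(\sum_j k3 j) / mu ^+ 3| <= lam / lo ^+ 3 / d%:R ^+ 2.
  have -> : lam / lo ^+ 3 / d%:R ^+ 2 = (d%:R * lam) / (lo * d%:R) ^+ 3.
    by field; rewrite !lt0r_neq0.
  rewrite mulr_suml kE; apply: ler_pM => //; first by rewrite invr_ge0 ltW.
    by apply: (le_trans (ler_norm_sum _ _ _)); exact: sum_ord.
  by rewrite lef_pV2 ?posrE ?exprn_gt0// ler_pXn2r// nnegrE; exact: ltW.
have ks : 2 * (1 - p) * `|(\sum_j k3 j) / mu ^+ 3| <= V / mu ^+ 2.
  rewrite mulr_suml kE mulrA ler_pdivrMr//.
  have -> : V / mu ^+ 2 * mu ^+ 3 = mu * V by field; exact: lt0r_neq0.
  exact: third_moment_small.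
have [VF0 concl] := mean_dim_algebra p1 p0 s0 D1 C10 sa kb ks hV.
split => //; apply: le_trans concl.
have mH : measurable_fun setT (fun x : R => (x / mu) `^ p).
  by apply: (measurableT_comp (measurable_powR p)); exact: measurable_funM.
have H0 (x : R) : 0 <= (x / mu) `^ p by exact: powR_ge0.
have fE (x : 'I_d -> R) : f x = ((\sum_j x j) / mu) `^ p by [].
apply: (mean_dim_pair_bound mz zI mH H0 fE sF VF0).
(* Adding the nonnegative diagonal terms completes the double sum of [v i * v j] to the square of
   [V]. *)
apply: (@le_trans _ _ (\sum_(i < d) \sum_(j < d)
    (p ^+ 2 * (p - 1) ^+ 2 / mu ^+ 4 * (1 + C1 / d%:R)) * (v i * v j))); last first.
  under eq_bigr => i _ do rewrite -mulr_sumr -mulr_sumr.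
  rewrite -mulr_sumr -mulr_suml -/V le_eqVlt; apply/orP; left; apply/eqP.
  by field; rewrite !lt0r_neq0.
apply: ler_sum => i _.
have c0 : 0 <= p ^+ 2 * (p - 1) ^+ 2 / mu ^+ 4.
  apply: divr_ge0; first by rewrite mulr_ge0 ?sqr_ge0.
  exact: exprn_even_ge0.
rewrite [leRHS](bigID (fun j => j != i))/=; apply: ler_wpDr.
  apply: sumr_ge0 => j _; exact: (mulr_ge0 (mulr_ge0 c0 C1D) (mulr_ge0 (v_ge0 i) (v_ge0 j))).
apply: ler_sum => j ji; rewrite eq_sym in ji.
have [J0' iW' EW] := pair_exponent ji.
have [_ [q1 [q2 [g1 s1 g2 s2 B]]]] := power_pair_bound mz zI zpos sz m0 p1 mu0 ji J0' iW'.
apply: (le_trans (anova_pair_bound mz zI mH H0 fE sF g1 s1 g2 s2)).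
apply: (le_trans B); rewrite -/(v i) -/(v j) -[leRHS]mulrA ler_wpM2l// [leRHS]mulrC.
exact: (ler_wpM2l (mulr_ge0 (v_ge0 i) (v_ge0 j)) EW).
Qed.

End fixed_dimension.

(** * From the stated hypotheses to real expectations *)

Section coordinates.
Context {dT : measure_display} {T : measurableType dT} {R : realType}.
Variable P : probability T R.

Lemma mutually_independent_ord (z : nat -> T -> R) (d : nat) (J : {set 'I_d})
    (B : 'I_d -> set R) : mutually_independent P z -> (forall j, measurable (B j)) ->
  (P (\bigcap_(j in [set` J]) z j @^-1` B j) = \prod_(j in J) P (z j @^-1` B j))%E.
Proof.
move=> zI mB.
pose s := [seq val j | j <- enum J].
pose J' : {fset nat} := seq_fset tt s.
pose B' (n : nat) : set R := if insub n is Some j then B j else setT.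
have B'E (j : 'I_d) : B' j = B j by rewrite /B' valK.
have memJ' n : (n \in J') = (n \in s) by rewrite seq_fsetE.
have sJ (j : 'I_d) : (val j \in s) = (j \in J) by rewrite mem_map ?mem_enum//; exact: val_inj.
have := zI J' B' _.
have -> : \bigcap_(j in [set` J']) z j @^-1` B' j = \bigcap_(j in [set` J]) z j @^-1` B j.
  apply/seteqP; split => w h.
    by move=> j /= jJ; rewrite -B'E; apply: h; rewrite /= memJ' sJ.
  move=> n /=; rewrite memJ' => /mapP[j]; rewrite mem_enum => jJ ->.
  by rewrite /= B'E; exact: h.
rewrite (perm_big s); last first.
  apply: uniq_perm; first exact: (fset_uniq J').
    by rewrite map_inj_uniq ?enum_uniq//; exact: val_inj.
  by move=> n; exact: memJ'.
rewrite big_map big_enum /= => ->.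
  by apply: eq_bigr => j _; rewrite B'E.
by move=> n _; rewrite /B'; case: insubP.
Qed.

(** The extended inverse is infinite where [X] vanishes, so a finite integral forces [X] to be
    positive almost everywhere. Only then does the real negative power, whose value at 0 is 0, have
    the same integral. *)
Lemma inverse_moment (X : T -> R) (alpha M : R) : measurable_fun setT X ->
  {ae P, forall w, 0 <= X w} -> 0 < alpha ->
  (\int[P]_w ((X w) `^ alpha)%:E^-1 <= M%:E)%E ->
  [/\ {ae P, forall w, 0 < X w}, intg P (fun w => X w `^ (- alpha)) &
      Ex P (fun w => X w `^ (- alpha)) <= M].
Proof.
move=> mX X0 a0 XM.
pose f w : \bar R := (((X w) `^ alpha)%:E^-1)%E.
have mXa : measurable_fun setT (fun w => X w `^ alpha).
  exact: (measurableT_comp (measurable_powR alpha)).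
have mXi : measurable_fun setT (fun w => X w `^ (- alpha)).
  exact: (measurableT_comp (measurable_powR (- alpha))).
have fE w : f w = if X w `^ alpha == 0 then +oo%E else (X w `^ (- alpha))%:E.
  by rewrite /f inver powRN.
have f0 w : (0 <= f w)%E by rewrite fE; case: ifP; rewrite ?leey// lee_fin powR_ge0.
have mf : measurable_fun setT f.
  rewrite (_ : f = fun w => if X w `^ alpha == 0 then +oo%E else (X w `^ (- alpha))%:E).
    apply: measurable_fun_ifT => //; last exact/measurable_EFinP.
    exact: measurable_fun_eqr.
  by apply/funext.
have fi : P.-integrable setT f.
  apply/integrableP; split => //; under eq_integral do rewrite gee0_abs//.
  by apply: le_lt_trans XM _; rewrite ltry.
have Xpos : {ae P, forall w, 0 < X w}.
  apply: filterS2 X0 (integrable_ae measurableT fi) => w Xw /(_ I).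
  rewrite lt_neqAle Xw andbT eq_sym; apply: contraL => /eqP X00.
  by rewrite fE X00 powR0 ?eqxx// gt_eqF.
have E : (\int[P]_w (X w `^ (- alpha))%:E <= M%:E)%E.
  apply: le_trans XM; rewrite le_eqVlt; apply/orP; left; apply/eqP.
  apply: ae_eq_integral => //; first exact/measurable_EFinP.
  by apply: filterS Xpos => w Xw _; rewrite -/(f w) fE gt_eqF// powR_gt0.
have iX : intg P (fun w => X w `^ (- alpha)).
  apply: intg_lty => //; first by move=> w; exact: powR_ge0.
  by apply: le_lt_trans E _; rewrite ltry.
by split => //; rewrite -lee_fin -Ex_fin.
Qed.

Lemma intg_ge0_expectation (X : T -> R) (c : R) : measurable_fun setT X ->
  {ae P, forall w, 0 <= X w} -> ('E_P[X] <= c%:E)%E -> intg P X.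
Proof.
move=> mX X0; rewrite unlock => Xc.
have mX' : measurable_fun setT (fun w => Num.max (X w) 0).
  by apply: measurable_maxr => //; exact: measurable_cst.
apply: (@intg_ae _ _ _ P X (fun w => Num.max (X w) 0)) => //; last first.
  by apply: filterS X0 => w Xw; rewrite max_l.
apply: intg_lty => //; first by move=> w; rewrite le_max lexx orbT.
apply: le_lt_trans (ltry c); apply: le_trans Xc.
rewrite le_eqVlt; apply/orP; left; apply/eqP.
apply: ae_eq_integral => //; [exact/measurable_EFinP..|].
by apply: filterS X0 => w Xw _; rewrite max_l.
Qed.

(** An even power is nonnegative, so a finite expectation already means integrability. *)
Lemma even_moment (X : T -> R) (k : nat) (c : R) : ~~ odd k -> measurable_fun setT X ->
  (`| 'E_P[fun w => (X w ^+ k)%R] | <= c%:E)%E ->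
  intg P (fun w => X w ^+ k) /\ Ex P (fun w => X w ^+ k) <= c.
Proof.
move=> ek mX; rewrite unlock => Xc.
have {}Xc := le_trans (lee_abs _) Xc.
have iX : intg P (fun w => X w ^+ k).
  apply: intg_lty; first exact: measurable_funX.
    by move=> w; exact: exprn_even_ge0.
  exact: le_lt_trans Xc (ltry c).
by split => //; rewrite -lee_fin -Ex_fin.
Qed.

Lemma variance_centered (X : T -> R) : sqint P X ->
  fine 'V_P[X] = Ex P (fun w => (X w - Ex P X) ^+ 2).
Proof.
move=> sX; rewrite (variance_Ex sX)/=.
have iX := sqint_intg sX; have [_ iX2] := sX.
have -> : (fun w => (X w - Ex P X) ^+ 2) =
    fun w => X w ^+ 2 + (- 2 * Ex P X * X w + Ex P X ^+ 2).
  by apply/funext => w; ring.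
have i1 := intgZ (- 2 * Ex P X) iX; have i2 := intgD i1 (intg_cst P (Ex P X ^+ 2)).
by rewrite (ExD iX2 i2) (ExD i1 (intg_cst _ _)) (ExZ _ iX) Ex_cst; ring.
Qed.

End coordinates.

Lemma nat_eventually_ge (R : realType) (x : R) :
  exists N : nat, forall d, (N <= d)%N -> x <= d%:R.
Proof.
exists (Num.Def.archi_bound `|x|) => d Nd.
apply: (le_trans (ler_norm x)); apply: (le_trans (ltW (archi_boundP (normr_ge0 x)))).
by rewrite ler_nat.
Qed.

Theorem theorem1 (dT : measure_display) (T : measurableType dT) (R : realType)
    (P : probability T R) (z : nat -> {RV P >-> R})
    (mu_lo mu_hi lam alpha M p : R)
    (z_indep : mutually_independent P (fun j => z j : T -> R))
    (z_ge0 : forall j, {ae P, forall w, 0 <= z j w})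
    (mu_lo_gt0 : 0 < mu_lo) (mu_lo_hi : mu_lo <= mu_hi) (alpha_gt0 : 0 < alpha)
    (mean_bounds : forall j, (mu_lo%:E <= 'E_P[z j] <= mu_hi%:E)%E)
    (moment_bounds : forall j k, (2 <= k <= 6)%N ->
      (`| 'E_P[fun w => ((z j w - fine 'E_P[z j]) ^+ k)%R] | <= lam%:E)%E)
    (* [((z j w) `^ alpha)%:E^-1] is +oo where [z j w = 0] *)
    (inv_moment_bounds : forall j,
      (\int[P]_w ((z j w) `^ alpha)%:E^-1 <= M%:E)%E)
    (p_neq0 : p != 0) (p_lt1 : p < 1) :
  exists C : R, \forall d \near \oo,
    0 < variance_sum P z d ->
    let f := power_fun P z p (d := d) in
    let zd := fun j : 'I_d => z j : T -> R in
    let fz := fun w => f (fun j => zd j w) in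
    [/\ fz \in Lfun P 2%:E,
        (0 < 'V_P[fz] < +oo)%E &
        mean_dim P zd f <=
          1 + (p - 1) ^+ 2 / 2 * (variance_sum P z d / mean_sum P z d ^+ 2)
            + C / d%:R ^+ 2].
Proof.
pose m j := Ex P (z j).
pose v j := Ex P (fun w => (z j w - m j) ^+ 2).
(* Enlarging the bound makes the positivity needed to divide by it immediate. *)
pose M' := Num.max M 1.
have mz j : measurable_fun setT (z j : T -> R) by exact: measurable_funP.
have iz j : intg P (z j).
  by apply: (@intg_ge0_expectation _ _ _ P _ mu_hi) => //; have /andP[] := mean_bounds j.
have Ez j : ('E_P[z j] = (m j)%:E)%E by rewrite unlock (Ex_fin (iz j)).
have mlo j : mu_lo <= m j by have := mean_bounds j; rewrite Ez !lee_fin => /andP[].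
have mhi j : m j <= mu_hi by have := mean_bounds j; rewrite Ez !lee_fin => /andP[].
have mx j : measurable_fun setT (fun w => z j w - m j).
  by apply: measurable_funB => //; exact: measurable_cst.
have mom j k : (2 <= k <= 6)%N ->
    (`| 'E_P[fun w => ((z j w - m j) ^+ k)%R] | <= lam%:E)%E.
  by move=> /(moment_bounds j); rewrite Ez.
have [ix2 v_le] : (forall j, intg P (fun w => (z j w - m j) ^+ 2)) /\ forall j, v j <= lam.
  by split => j; have [] := even_moment (isT : ~~ odd 2) (mx j) (mom j 2 isT).
have [ix4 k4_le] : (forall j, intg P (fun w => (z j w - m j) ^+ 4)) /\
    forall j, Ex P (fun w => (z j w - m j) ^+ 4) <= lam.
  by split => j; have [] := even_moment (isT : ~~ odd 4) (mx j) (mom j 4 isT).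
have sz j : sqint P (z j).
  have sx : sqint P (fun w => z j w - m j) by [].
  have := sqintD sx (sqint_cst P (m j)).
  by congr (sqint P _); apply/funext => w; rewrite subrK.
(* The cube is dominated by the second and fourth powers, by [cube_le_amgm] with weight 1. *)
have ix3 j : intg P (fun w => (z j w - m j) ^+ 3).
  apply: (intg_dom _ (intgZ 2^-1 (intgD (intgZ 1 (ix2 j)) (intgZ 1^-1 (ix4 j))))).
    exact: measurable_funX.
  by apply: aeW => w; exact: cube_le_amgm.
have k3_le j : `|Ex P (fun w => (z j w - m j) ^+ 3)| <= lam.
  by have := mom j 3 isT; rewrite unlock (Ex_fin (ix3 j)) abse_EFin lee_fin.
have inv j := inverse_moment (mz j) (z_ge0 j) alpha_gt0 (inv_moment_bounds j).
have zpos j : {ae P, forall w, 0 < z j w} by case: (inv j).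
have iza j : intg P (fun w => z j w `^ (- alpha)) by case: (inv j).
have Eza j : Ex P (fun w => z j w `^ (- alpha)) <= M'.
  by case: (inv j) => _ _ h; rewrite le_max h.
have M1 : 1 <= M' by rewrite le_max lexx orbT.
have meanE d : mean_sum P z d = \sum_(j < d) m j.
  by apply: eq_bigr => j _; rewrite Ez.
have varE d : variance_sum P z d = \sum_(j < d) v j.
  by apply: eq_bigr => j _; rewrite variance_centered.
have v0 j : 0 <= v j by exact: Ex_sqr_ge0.
(* If all the z_j are degenerate, the claim is vacuous; otherwise the total variance is
   eventually bounded away from 0, because it is nondecreasing in d. *)
have [[d0 V0]|nV] := pselect (exists d0, 0 < variance_sum P z d0); last first.
  by exists 0; apply: nearW => d Vd; exfalso; apply: nV; exists d.
pose q := 4 - 2 * p.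
pose K := (4 * mu_hi) `^ (q + 2) * M' `^ ((q + 2) / alpha).
exists (asymptotic_const p (pair_const q lam mu_lo mu_hi K)
  (lam / mu_lo ^+ 2) (lam / mu_lo ^+ 3)).
have [N1 hN1] := nat_eventually_ge (4 * (q + 2) / alpha).
have [N2 hN2] := nat_eventually_ge
  (4 * (1 - p) ^+ 2 * lam / mu_lo ^+ 2 / variance_sum P z d0).
(* The four thresholds serve, in order, the size of the halves, a variance at least that of [d0],
   the existence of the negative moments, and the smallness of the third cumulant. *)
exists (maxn 6 (maxn d0 (maxn N1 N2))) => // d /=.
rewrite !geq_max => /and4P[d6 dd0 dN1 dN2] Vd.
have Vmono : variance_sum P z d0 <= variance_sum P z d.
  rewrite !varE -!(big_mkord xpredT v) [leRHS](@big_cat_nat _ _ _ d0)//= lerDl.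
  exact: sumr_ge0.
have zposd : {ae P, forall w, forall j : 'I_d, 0 < z j w}.
  suff : \forall w \ae P, forall j : 'I_d, j \in enum 'I_d -> 0 < z j w.
    by apply: filterS => w h j; apply: h; rewrite mem_enum.
  elim: (enum 'I_d) => [|i s IH]; first by apply: aeW.
  apply: filterS2 (zpos i) IH => w h1 h2 j; rewrite inE => /predU1P[->//|].
  exact: h2.
have d_exp : 4 * (q + 2) <= alpha * d%:R.
  by rewrite [alpha * _]mulrC -ler_pdivrMr//; exact: hN1.
have d_var : 4 * (1 - p) ^+ 2 * lam / mu_lo ^+ 2 <= d%:R * \sum_(j < d) v j.
  rewrite -varE; have := hN2 _ dN2; rewrite ler_pdivrMr// => h; apply: (le_trans h).
  exact: ler_wpM2l.
have zI (J : {set 'I_d}) (B : 'I_d -> set R) : (forall j, measurable (B j)) ->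
    (P (\bigcap_(j in [set` J]) z j @^-1` B j) = \prod_(j in J) P (z j @^-1` B j))%E.
  by move=> mB; exact: (@mutually_independent_ord _ _ _ P (fun j => z j : T -> R)).
rewrite varE in Vd.
have [sF VF0 bound] := @mean_dim_fixed _ _ _ P d (fun j => z j : T -> R)
  (fun j => mz j) zI alpha M' mu_lo mu_hi lam p alpha_gt0 M1 zposd (fun j => iza j)
  (fun j => Eza j) (fun j => m j) (fun j => sz j) (fun j => erefl) (fun j => ix3 j)
  (fun j => ix4 j) mu_lo_gt0 (fun j => mlo j) (fun j => mhi j) (fun j => v_le j)
  (fun j => k3_le j) (fun j => k4_le j) p_lt1 p_neq0 d6 d_exp d_var Vd.
rewrite /power_fun meanE varE; split => //.
- exact/sqint_Lfun.
- by move: VF0; rewrite (variance_Ex sF)/= lte_fin ltry andbT.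
Qed.
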